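(* Let $(G;X)$ be a regular polar space with quotient space $Q=X/G$, and let $u:H\rightarrow G_Q$ be the inclusion of the isotropy of a regular section $x:Q\rightarrow X$ of the quotient map. The functors $\mathrm{Br}^*$ and $\mathrm{C}$ form an equivalence of categories $$\mathrm{Br}^*:\mathrm{Pol.Cov.}(G;X;x) \longleftrightarrow \mathrm{E}(G;X;x):\mathrm{C}.$$
   Context: Polar spaces. A polar space is a couple $(G;X)$ of a Lie group $G$ acting continuously and faithfully on a Hausdorff, connected, locally path-connected, semi-locally simply connected space $X$ such that: (1) $Q:=X/G$ is simply connected; (2) the quotient map $X\to Q$ admits a continuous section $x$; (3) the map $\phi_x:G\times Q\to X$, $(g;q)\mapsto g\cdot x(q)$, is a quotient map. The isotropy of $x$ is $H=\{(g;q)\in G\times Q\mid g\cdot x(q)=x(q)\}$, a closed subspace of $G_Q:=G\times Q$ and a subgroup over $Q$ (fibres $H_q$). For $y\in G\times Q$, $\|y\|$ denotes its image in $Q$. Regularity. The section $x$ is regular if for every $q\in Q$ there are an open neighbourhood $U$ of $x(q)$ and a deformation retraction $h:[0;1]\times\phi_x^{-1}(U)\to\phi_x^{-1}(U)$ of $\phi_x^{-1}(U)$ onto $H_q\times\{q\}$ such that (1) $h_t(\phi_x^{-1}(U)\cap H)\subset\phi_x^{-1}(U)\cap H$ for all $t$; (2) if $y,z\in\phi_x^{-1}(U)$ lie over the same point of $Q$, the paths $t\mapsto\|h_t(y)\|$ and $t\mapsto\|h_t(z)\|$ coincide. A polar space is regular if it admits a regular section. Groups over $Q$. A $Q$-group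 is a (Hausdorff, locally path-connected) topological space over $Q$ with continuous fibrewise group structure over $Q$; morphisms are continuous maps over $Q$ that are fibrewise group morphisms. For a Lie group $K$, $K_Q=K\times Q\to Q$; a morphism $f$ of Lie groups induces $f_Q=f\times\mathrm{id}_Q$. A morphism $f:H\to K_Q$ of $Q$-groups is ubiquitous if the quotient of $K_Q$ by right multiplication by $f(H)$ (fibrewise over $Q$) is connected. Polar coverings. For a connected covering $p_{X'}:X'\to X$, let $G'$ be the group of homeomorphisms $g'$ of $X'$ for which there is a (unique) $g\in G$ with $p_{X'}\circ g'=g\circ p_{X'}$; set $p_{G'}(g')=g$. $G'$ carries the unique topology for which $p_{G'}$ is continuous and a covering of its image and the action $G'\times X'\to X'$ is continuous. The covering is polar if it is connected, Galois, and $p_{G'}:G'\to G$ is surjective. A discrete extension of $G$ is a Lie group $G'$ with a surjective morphism $p_{G'}:G'\to G$ with discrete kernel. The category $\mathrm{Pol.Cov.}(G;X;x)$: objects are polar coverings $X'$ of $X$ endowed with a lift $x':Q\to X'$ of $x$ along $p_{X'}$; morphisms $(X_1',x_1')\to(X_2',x_2')$ are continuous maps $f$ with $p_{X_2'}\circ f=p_{X_1'}$ and $f\circ x_1'=x_2'$. The category $\mathrm{E}(G;X;x)$: objects are discrete extensions $G'$ of $G$ endowed with a ubiquitous morphism of $Q$-groups $u':H\to G'_Q$ lifting $u$, i.e. $(p_{G'})_Q\circ u'=u$; morphisms $(G_1',u_1')\to(G_2',u_2')$ are morphisms of Lie groups $f$ with $p_{G_2'}\circ f=p_{G_1'}$ and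 $f_Q\circ u_1'=u_2'$. The functors. $\mathrm{Br}^*$ sends $(X',x')$ to $(G',u')$, where $G'$ is the discrete extension associated to $X'$ above and $u'$ is the inverse of the isomorphism $H'\to H$ induced by $(p_{G'})_Q$ (with $H'\subset G'_Q$ the isotropy of $x'$ for the action of $G'$ on $X'$), composed with the inclusion $H'\subset G'_Q$. $\mathrm{C}$ sends $(G',u')$ to the quotient $X'=G'_Q/u'(H)$ with projection to $X$ induced by $\phi_x\circ(p_{G'})_Q$ and the lift $x'$ of $x$ induced by $q\mapsto(1;q)$.
   Formalization: Lie groups may have uncountably many components, and the surjective morphism of a discrete extension is also required to be open (automatic for countably many components); without this the claim fails, e.g. for the discrete reals mapping to the reals. *)

(* Defs.v *)
From HB Require Import structures.
From Stdlib Require Import Relation_Operators.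
From mathcomp Require Import all_boot all_order all_algebra.
From mathcomp Require Import generic_quotient.
From mathcomp Require Import all_classical all_reals all_analysis.

Set Implicit Arguments.
Unset Strict Implicit.
Unset Printing Implicit Defensive.

Import Order.TTheory GRing.Theory Num.Theory.
Import numFieldNormedType.Exports.

Local Open Scope classical_set_scope.
Local Open Scope ring_scope.

(** * Categories *)

Record category := Category {
  Ob :> Type;
  Hom : Ob -> Ob -> Type;
  idm : forall a, Hom a a;
  compm : forall a b c, Hom b c -> Hom a b -> Hom a c;
  compm1 : forall a b (f : Hom a b), compm f (idm a) = f;
  comp1m : forall a b (f : Hom a b), compm (idm b) f = f;
  compmA : forall a b c d (f : Hom c d) (g : Hom b c) (h : Hom a b),
    compm f (compm g h) = compm (compm f g) h
}.
Arguments idm {_} _.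

Record functor (C D : category) := Functor {
  fobj :> C -> D;
  fmap : forall a b : C, Hom a b -> Hom (fobj a) (fobj b);
  fmap1 : forall a : C, fmap (idm a) = idm (fobj a);
  fmapM : forall (a b c : C) (f : Hom b c) (g : Hom a b),
    fmap (compm f g) = compm (fmap f) (fmap g)
}.

Definition functor_id (C : category) : functor C C :=
  @Functor C C id (fun _ _ => id) (fun _ => erefl) (fun _ _ _ _ _ => erefl).

Section functor_comp.
Variables (C D E : category) (F : functor D E) (F' : functor C D).

Lemma functor_comp1 (a : C) :
  fmap F (fmap F' (idm a)) = idm (F (F' a)).
Proof. by rewrite !fmap1. Qed.

Lemma functor_compM (a b c : C) (f : Hom b c) (g : Hom a b) :
  fmap F (fmap F' (compm f g)) =
  compm (fmap F (fmap F' f)) (fmap F (fmap F' g)).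
Proof. by rewrite !fmapM. Qed.

Definition functor_comp : functor C E :=
  @Functor C E (fun a => F (F' a)) (fun a b f => fmap F (fmap F' f))
    functor_comp1 functor_compM.

End functor_comp.

Definition naturally_isomorphic (C D : category) (F F' : functor C D) : Prop :=
  exists (s : forall a : C, Hom (F a) (F' a))
         (t : forall a : C, Hom (F' a) (F a)),
    [/\ forall a, compm (t a) (s a) = idm (F a),
        forall a, compm (s a) (t a) = idm (F' a) &
        forall (a b : C) (f : Hom a b),
          compm (fmap F' f) (s a) = compm (s b) (fmap F f)].

Definition equivalence_of_categories (C D : category)
    (F : functor C D) (F' : functor D C) : Prop :=
  naturally_isomorphic (functor_comp F' F) (functor_id C) /\
  naturally_isomorphic (functor_comp F F') (functor_id D).

(** * Topology *)

Definition homeo (S T : topologicalType) (f : S -> T) : Prop :=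
  continuous f /\
  exists2 g : T -> S, continuous g & cancel f g /\ cancel g f.

Definition open_map (S T : topologicalType) (f : S -> T) : Prop :=
  forall U : set S, open U -> open (f @` U).

Definition quotient_map (S T : topologicalType) (f : S -> T) : Prop :=
  [/\ continuous f, range f = [set: T] &
      forall U : set T, open (f @^-1` U) -> open U].

(* Since [U] is open in [B], the last two conditions on a sheet [W] say that
   [p] restricts to a homeomorphism of [W] onto [U]. *)
Definition covering_map (E B : topologicalType) (p : E -> B) : Prop :=
  continuous p /\
  forall b : B, exists2 U : set B, open_nbhs b U &
    exists S : set (set E),
      [/\ p @^-1` U = \bigcup_(W in S) W, trivIset S id &
          forall W, S W -> [/\ open W, set_bij W U p &
            forall V, open V -> V `<=` W -> open (p @` V)]].

(* The quotient of [T] by the equivalence relation generated by [r], with the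
   quotient topology. *)
Section quot_space.
Local Open Scope quotient_scope.
Variables (T : topologicalType) (r : T -> T -> Prop).

Let gen (a b : T) : bool := `[< clos_refl_sym_trans T r a b >].

Let gen_refl : reflexive gen.
Proof. by move=> a; apply/asboolP; exact: rst_refl. Qed.

Let gen_sym : symmetric gen.
Proof. by move=> a b; apply: asbool_equiv_eq; split; exact: rst_sym. Qed.

Let gen_trans : transitive gen.
Proof.
by move=> b a c /asboolP ab /asboolP bc; apply/asboolP; exact: rst_trans bc.
Qed.

Definition gen_equiv : equiv_rel T := EquivRel gen gen_refl gen_sym gen_trans.

Definition quot_space : topologicalType :=
  quotient_topology {eq_quot gen_equiv}.

Definition quot_pi : T -> quot_space :=
  \pi_(quotient_topology {eq_quot gen_equiv}).

End quot_space.

Section homotopy.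
Variable R : realType.

Local Notation I := (`[0, 1]%classic : set R).

Definition is_path (T : topologicalType) (f : R -> T) : Prop :=
  {within I, continuous f}.

Definition path_connected (T : topologicalType) (A : set T) : Prop :=
  A !=set0 /\
  forall x y, A x -> A y -> exists f : R -> T,
    [/\ is_path f, f 0 = x, f 1 = y & f @` I `<=` A].

Definition locally_path_connected (T : topologicalType) : Prop :=
  forall (x : T) (U : set T), nbhs x U ->
    exists V : set T, [/\ open_nbhs x V, V `<=` U & path_connected V].

Definition null_homotopic (T : topologicalType) (f : R -> T) : Prop :=
  exists h : R * R -> T,
    [/\ {within I `*` I, continuous h},
        forall t, I t -> h (0, t) = f t,
        forall t, I t -> h (1, t) = f 0 &
        forall s, I s -> h (s, 0) = f 0 /\ h (s, 1) = f 0].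

Definition simply_connected (T : topologicalType) : Prop :=
  path_connected [set: T] /\
  forall f : R -> T, is_path f -> f 0 = f 1 -> null_homotopic f.

Definition semi_locally_simply_connected (T : topologicalType) : Prop :=
  forall x : T, exists2 U : set T, nbhs x U &
    forall f : R -> T, is_path f -> f @` I `<=` U ->
      f 0 = x -> f 1 = x -> null_homotopic f.

(* The points of [A] are only required to be fixed at time 1, so that strong
   deformation retractions are a special case. *)
Definition deformation_retraction (T : topologicalType) (D A : set T)
    (h : R -> T -> T) : Prop :=
  A `<=` D /\
  [/\ {within I `*` D, continuous (fun z : R * T => h z.1 z.2)},
      forall t y, I t -> D y -> D (h t y),
      forall y, D y -> h 0 y = y,
      forall y, D y -> A (h 1 y) &
      forall y, A y -> h 1 y = y].

End homotopy.

(** * Lie groups *)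

HB.mixin Record isTopologicalGroup G of monoid.Group G & Topological G := {
  mulg_continuous : continuous (fun z : G * G => z.1 * z.2)%g;
  invg_continuous : continuous (fun g : G => g^-1)%g
}.

#[short(type="topGroupType")]
HB.structure Definition TopologicalGroup :=
  {G of isTopologicalGroup G & monoid.Group G & Topological G}.

Section smooth.
Variable R : realType.

(* Used with [V] and [W] finite-dimensional and [U] open only. *)
Fixpoint class_C (V W : normedModType R) (k : nat) (U : set V) (f : V -> W)
    : Prop :=
  if k is k'.+1 then
    (forall x, U x -> differentiable f x) /\
    forall v : V, class_C k' U ('D_v f)
  else forall x, U x -> {for x, continuous f}.

Definition smooth (V W : normedModType R) (U : set V) (f : V -> W) : Prop :=
  forall k, class_C k U f.

Record chart (T : topologicalType) (n : nat) := Chart {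
  chart_dom : set T;
  chart_cod : set 'rV[R]_n;
  chart_fun :> T -> 'rV[R]_n;
  chart_inv : 'rV[R]_n -> T;
  chart_dom_open : open chart_dom;
  chart_cod_open : open chart_cod;
  chart_homo : forall x, chart_dom x -> chart_cod (chart_fun x);
  chart_inv_homo : forall v, chart_cod v -> chart_dom (chart_inv v);
  chartK : forall x, chart_dom x -> chart_inv (chart_fun x) = x;
  chart_invK : forall v, chart_cod v -> chart_fun (chart_inv v) = v;
  chart_continuous : {within chart_dom, continuous chart_fun};
  chart_inv_continuous : {within chart_cod, continuous chart_inv}
}.

Definition smooth_atlas (T : topologicalType) (n : nat)
    (A : set (chart T n)) : Prop :=
  (forall x, exists2 c, A c & chart_dom c x) /\
  forall c d, A c -> A d ->
    smooth (chart_cod c `&` chart_inv c @^-1` chart_dom d)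
           (fun v => d (chart_inv c v)).

Definition smooth_group_law (G : topGroupType) (n : nat)
    (A : set (chart G n)) : Prop :=
  (forall c d e, A c -> A d -> A e ->
    smooth [set z | [/\ chart_cod c z.1, chart_cod d z.2 &
                        chart_dom e (chart_inv c z.1 * chart_inv d z.2)%g]]
      (fun z : 'rV[R]_n * 'rV[R]_n =>
         e (chart_inv c z.1 * chart_inv d z.2)%g)) /\
  (forall c d, A c -> A d ->
    smooth [set v | chart_cod c v /\ chart_dom d (chart_inv c v)^-1%g]
      (fun v => d (chart_inv c v)^-1%g)).

End smooth.

(* The smooth structure of a Lie group is determined by its topological group
   structure, and continuous homomorphisms between Lie groups are smooth.
   Therefore being a Lie group is a property of topological groups here, and
   morphisms of Lie groups are continuous homomorphisms. Lie groups may have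
   uncountably many components. *)
HB.mixin Record isLieGroup (R : realType) G of TopologicalGroup G := {
  lie_hausdorff : hausdorff_space G;
  lie_smooth : exists (n : nat) (A : set (chart R G n)),
    smooth_atlas A /\ smooth_group_law A
}.

#[short(type="lieGroupType")]
HB.structure Definition LieGroup (R : realType) :=
  {G of isLieGroup R G & TopologicalGroup G}.

Definition lie_morphism (G K : topGroupType) (f : G -> K) : Prop :=
  continuous f /\ {morph f : g h / (g * h)%g}.

(* For a surjective morphism with discrete kernel, openness is what makes
   [G'] an extension of [G] as a topological group, i.e. [G' / ker p = G]. It
   is automatic when [G'] has countably many components, but not in general:
   see the identity from the discrete group of reals to the reals. *)
Definition discrete_extension (G' G : topGroupType) (p : G' -> G) : Prop :=
  [/\ lie_morphism p, range p = [set: G], open_map p &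
      exists2 U : set G', nbhs 1%g U & U `&` p @^-1` [set 1%g] = [set 1%g]].

(** * Polar spaces *)

Section polar_spaces.
Variables (R : realType) (G : lieGroupType R) (X : topologicalType).
Variable act : G -> X -> X.

Definition orbit_space : topologicalType :=
  quot_space (fun y z => exists g, act g y = z).

Local Notation Q := orbit_space.

Definition orbit_pi : X -> Q := quot_pi (fun y z => exists g, act g y = z).

Definition continuous_faithful_action : Prop :=
  [/\ continuous (fun z : G * X => act z.1 z.2),
      forall y, act 1%g y = y,
      forall g h y, act (g * h)%g y = act g (act h y) &
      forall g, (forall y, act g y = y) -> g = 1%g].

Definition phi (x : Q -> X) (z : G * Q) : X := act z.1 (x z.2).

Definition polar_section (x : Q -> X) : Prop :=
  [/\ continuous x, cancel x orbit_pi & quotient_map (phi x)].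

Definition polar_space : Prop :=
  [/\ continuous_faithful_action,
      [/\ hausdorff_space X, connected [set: X],
          locally_path_connected R X & semi_locally_simply_connected R X],
      simply_connected R Q &
      exists x, polar_section x].

Definition isotropy (x : Q -> X) : set (G * Q) :=
  [set z | act z.1 (x z.2) = x z.2].

Definition regular_section (x : Q -> X) : Prop :=
  forall q : Q, exists2 U : set X, open_nbhs (x q) U &
    exists h : R -> G * Q -> G * Q,
      let D := phi x @^-1` U in
      [/\ deformation_retraction D
            (isotropy x `&` [set z | z.2 = q]) h,
          forall t z, `[0, 1]%classic t -> (D `&` isotropy x) z ->
            (D `&` isotropy x) (h t z) &
          forall y z, D y -> D z -> y.2 = z.2 ->
            forall t, `[0, 1]%classic t -> (h t y).2 = (h t z).2].

Definition regular_polar_space : Prop :=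
  polar_space /\ exists2 x, polar_section x & regular_section x.

Variable x : Q -> X.

Local Notation H := (isotropy x).

(** ** Morphisms of groups over the orbit space *)

(* The trivial group [K_Q] over [Q] is the product [K * Q], and [H] is the
   subgroup [isotropy x] of [G_Q], with the subspace topology. *)
Definition qgroup_morphism (K : topGroupType) (f : H -> K * Q) : Prop :=
  [/\ continuous f,
      forall h : H, (f h).2 = (set_val h).2 &
      forall h k l : H, (set_val h).2 = (set_val k).2 ->
        set_val l = ((set_val h).1 * (set_val k).1, (set_val h).2)%g ->
        (f l).1 = ((f h).1 * (f k).1)%g].

Definition coset_rel (K : topGroupType) (f : H -> K * Q) (y z : K * Q) : Prop :=
  exists h : H, (f h).2 = y.2 /\ z = (y.1 * (f h).1, y.2)%g.

Definition ubiquitous (K : topGroupType) (f : H -> K * Q) : Prop :=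
  connected [set: quot_space (coset_rel f)].

(** ** Polar coverings *)

Definition lifts_action (X' : topologicalType) (p : X' -> X) (g : G)
    (g' : X' -> X') : Prop :=
  homeo g' /\ forall y, p (g' y) = act g (p y).

Definition galois (X' : topologicalType) (p : X' -> X) : Prop :=
  forall y z, p y = p z ->
    exists d : X' -> X', [/\ homeo d, forall w, p (d w) = p w & d y = z].

Definition polar_covering (X' : topologicalType) (p : X' -> X) : Prop :=
  [/\ covering_map p, connected [set: X'], galois p &
      forall g : G, exists g', lifts_action p g g'].

Record polcov := PolCov {
  pc_space :> topologicalType;
  pc_proj : pc_space -> X;
  pc_lift : Q -> pc_space;
  pc_polar : polar_covering pc_proj;
  pc_lift_continuous : continuous pc_lift;
  pc_liftP : forall q, pc_proj (pc_lift q) = x q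
}.

Record polcov_hom (P1 P2 : polcov) := PolCovHom {
  pch_fun :> P1 -> P2;
  pch_continuous : continuous pch_fun;
  pch_proj : forall y, pc_proj (pch_fun y) = pc_proj y;
  pch_lift : forall q, pch_fun (pc_lift P1 q) = pc_lift P2 q
}.

Lemma polcov_hom_eq (P1 P2 : polcov) (f g : polcov_hom P1 P2) :
  pch_fun f = pch_fun g -> f = g.
Proof.
case: f g => f f1 f2 f3 [g g1 g2 g3] /= fg; case: g / fg g1 g2 g3 => g1 g2 g3.
by congr PolCovHom; exact: Prop_irrelevance.
Qed.

Definition polcov_id (P : polcov) : polcov_hom P P :=
  @PolCovHom P P id (fun _ => cvg_id) (fun _ => erefl) (fun _ => erefl).

Section polcov_comp.
Variables (P1 P2 P3 : polcov) (f : polcov_hom P2 P3) (g : polcov_hom P1 P2).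

Let comp_continuous : continuous (f \o g).
Proof.
by move=> y; apply: continuous_comp; [exact: pch_continuous|
  exact: pch_continuous].
Qed.

Let comp_proj y : pc_proj ((f \o g) y) = pc_proj y.
Proof. by rewrite /= !pch_proj. Qed.

Let comp_lift q : (f \o g) (pc_lift P1 q) = pc_lift P3 q.
Proof. by rewrite /= !pch_lift. Qed.

Definition polcov_comp : polcov_hom P1 P3 :=
  PolCovHom comp_continuous comp_proj comp_lift.

End polcov_comp.

Definition Pol_Cov : category.
Proof.
refine (@Category polcov polcov_hom polcov_id polcov_comp _ _ _).
- by move=> P1 P2 f; exact: polcov_hom_eq.
- by move=> P1 P2 f; exact: polcov_hom_eq.
- by move=> P1 P2 P3 P4 f g h; exact: polcov_hom_eq.
Defined.

(** ** Discrete extensions *)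

Record ext := Ext {
  ext_group :> lieGroupType R;
  ext_proj : ext_group -> G;
  ext_u : H -> ext_group * Q;
  ext_discrete : discrete_extension ext_proj;
  ext_qgroup : qgroup_morphism ext_u;
  ext_ubiquitous : ubiquitous ext_u;
  ext_lift : forall h : H, (ext_proj (ext_u h).1, (ext_u h).2) = set_val h
}.

Record ext_hom (E1 E2 : ext) := ExtHom {
  eh_fun :> E1 -> E2;
  eh_morphism : lie_morphism eh_fun;
  eh_proj : forall g, ext_proj (eh_fun g) = ext_proj g;
  eh_u : forall h : H, (eh_fun (ext_u E1 h).1, (ext_u E1 h).2) = ext_u E2 h
}.

Lemma ext_hom_eq (E1 E2 : ext) (f g : ext_hom E1 E2) :
  eh_fun f = eh_fun g -> f = g.
Proof.
case: f g => f f1 f2 f3 [g g1 g2 g3] /= fg; case: g / fg g1 g2 g3 => g1 g2 g3.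
by congr ExtHom; exact: Prop_irrelevance.
Qed.

Section ext_id.
Variable E : ext.

Let id_morphism : lie_morphism (@id E).
Proof. by split => // y; exact: cvg_id. Qed.

Let id_u (h : H) : (id (ext_u E h).1, (ext_u E h).2) = ext_u E h.
Proof. by case: (ext_u E h). Qed.

Definition ext_id : ext_hom E E :=
  ExtHom id_morphism (fun _ => erefl) id_u.

End ext_id.

Section ext_comp.
Variables (E1 E2 E3 : ext) (f : ext_hom E2 E3) (g : ext_hom E1 E2).

Let comp_morphism : lie_morphism (f \o g).
Proof.
have [fc fM] := eh_morphism f; have [gc gM] := eh_morphism g.
split; last by move=> a b /=; rewrite gM fM.
by move=> y; apply: continuous_comp; [exact: gc|exact: fc].
Qed.

Let comp_proj y : ext_proj ((f \o g) y) = ext_proj y.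
Proof. by rewrite /= !eh_proj. Qed.

Let comp_u (h : H) : ((f \o g) (ext_u E1 h).1, (ext_u E1 h).2) = ext_u E3 h.
Proof. by rewrite -(eh_u f) -(eh_u g). Qed.

Definition ext_comp : ext_hom E1 E3 := ExtHom comp_morphism comp_proj comp_u.

End ext_comp.

Definition E_cat : category.
Proof.
refine (@Category ext ext_hom ext_id ext_comp _ _ _).
- by move=> E1 E2 f; exact: ext_hom_eq.
- by move=> E1 E2 f; exact: ext_hom_eq.
- by move=> E1 E2 E3 E4 f g h; exact: ext_hom_eq.
Defined.

(** ** The functors *)

(* [br_group_spec a] identifies, through the action [a] of [E] on [P], the
   group underlying [E] with the group of the homeomorphisms of [P] that lift
   some element of [G], the map [ext_proj] with the map sending such a
   homeomorphism to the element that it lifts, and the topology of [E] with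
   the one which makes this map a covering (of its image, which is [G] as [P]
   is polar) and the action continuous. *)
Definition br_group_spec (P : polcov) (E : ext) (a : E -> P -> P) : Prop :=
  [/\ injective a,
      range a = [set g' | exists g, lifts_action (@pc_proj P) g g'],
      forall g h y, a (g * h)%g y = a g (a h y) &
      forall g y, pc_proj (a g y) = act (ext_proj g) (pc_proj y)] /\
  (covering_map (@ext_proj E) /\ continuous (fun z : E * P => a z.1 z.2)).

Definition cov_isotropy (P : polcov) (E : ext) (a : E -> P -> P)
    : set (E * Q) :=
  [set z | a z.1 (pc_lift P z.2) = pc_lift P z.2].

(* [ext_u] is the inverse of the map from [cov_isotropy a] to [H] induced by
   [ext_proj]. *)
Definition br_u_spec (P : polcov) (E : ext) (a : E -> P -> P) : Prop :=
  (forall h : H, cov_isotropy a (ext_u E h)) /\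
  (forall (z : E * Q) (h : H), cov_isotropy a z ->
     set_val h = (ext_proj z.1, z.2) -> ext_u E h = z).

(* Characterizes the functor Br^* up to unique natural isomorphism. *)
Definition Br_functor (Br : functor Pol_Cov E_cat)
    (a : forall P : polcov, (Br P : ext) -> P -> P) : Prop :=
  (forall P : polcov, br_group_spec (@a P) /\ br_u_spec (@a P)) /\
  (forall (P1 P2 : polcov) (f : polcov_hom P1 P2) (g : (Br P1 : ext)) (y : P1),
     f (a P1 g y) = a P2 ((fmap Br f : ext_hom (Br P1) (Br P2)) g) (f y)).

(* The quotient of [E * Q] by [ext_u], through the projection [k]. *)
Definition c_space_spec (E : ext) (P : polcov) (k : E * Q -> P) : Prop :=
  [/\ quotient_map k,
      forall y z, k y = k z <-> coset_rel (ext_u E) y z,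
      forall z, pc_proj (k z) = phi x (ext_proj z.1, z.2) &
      forall q, pc_lift P q = k (1%g, q)].

(* Characterizes the functor C up to unique natural isomorphism. *)
Definition C_functor (C : functor E_cat Pol_Cov)
    (k : forall E : ext, E * Q -> (C E : polcov)) : Prop :=
  (forall E : ext, c_space_spec (@k E)) /\
  (forall (E1 E2 : ext) (f : ext_hom E1 E2) (z : E1 * Q),
     (fmap C f : polcov_hom (C E1) (C E2)) (k E1 z) = k E2 (f z.1, z.2)).

End polar_spaces.

(* Main.v *)
From HB Require Import structures.
From Stdlib Require Import Relation_Operators.
Require Import Defs.
From mathcomp Require Import all_boot all_order all_algebra.
From mathcomp Require Import all_classical all_reals all_analysis.
From mathcomp Require Import lra.

Set Implicit Arguments.
Unset Strict Implicit.
Unset Printing Implicit Defensive.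

Import Order.TTheory GRing.Theory Num.Theory.
Import numFieldNormedType.Exports.

Local Open Scope classical_set_scope.

(** Both functors are made of the same picture: a polar covering [P] with a lift
    of the section is the quotient of [E * Q] by the isotropy, where [E] is the
    group of all lifts to [P] of elements of [G], and [E] is recovered from this
    quotient as the group of all lifts.

    Joint continuity ([covering_lift_continuous]). A map of two variables into a
    covering space that lifts a continuous map, and that is continuous in the
    second variable, which runs over a connected and locally connected space, is
    jointly continuous as soon as it is continuous in the first variable for one
    value of the second. It makes the actions continuous, and it turns path
    lifting ([ext_path_lift]) into homotopy lifting.

    From coverings to extensions. A lift of [g] is determined by its value at a
    base point, so the group of lifts is the pullback of the covering [P -> X]
    along the orbit map of the base point ([covering_pullback]); with this
    topology it covers [G], and joint continuity makes its action on [P]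
    continuous. Conversely a map into the group is continuous once its
    projection to [G] and the image of one, possibly moving, point of [P] are
    ([lift_group_continuous]); this gives the continuity of the group law, of
    the morphism [br_u] from the isotropy and of all the comparison maps. Charts
    lift through local sections ([covering_lie_structure]). The orbit map of the
    lifted section is a quotient map from [E * Q] to [P] whose fibres are the
    cosets of the isotropy ([lift_group_quotient], [coset_relP]), so the
    quotient is connected.

    From extensions to coverings. The kernel of [E -> G] acts freely, and
    transitively on the fibres, on the quotient of [E * Q] by the image of
    [ext_u], so only the local injectivity of the projection to [X] has to be
    proved, and [E] moves every point to the class of some [(1, q)]. There
    regularity enters ([regular_slice]): the deformation retraction lifts to [E
    * Q], and the points whose lifted path ends in the image of [ext_u] form an
    open set that meets each orbit of the kernel in at most one coset. It is
    saturated because the retraction preserves the isotropy and moves all points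
    over one point of [Q] along the same path of [Q], so that a point and its
    translate by the isotropy can be moved together.

    For any choice of the two functors, [P] and the quotient attached to its
    group of lifts are quotients of one space by one relation
    ([C_Br_isomorphic]); and [E] acts on its quotient as the group of all lifts
    ([coset_lift_group]), while this group has only one topology with a
    continuous action ([lift_group_hom]), which gives [Br_C_isomorphic]. *)

(** * Covering maps *)

Section clopen.
Variable T : topologicalType.

Lemma connected_local_property (P : T -> Prop) (t0 : T) :
  connected [set: T] -> (forall t, \forall s \near t, P s <-> P t) ->
  P t0 -> forall t, P t.
Proof.
move=> Tconn Ploc Pt0 t.
have oP : open [set s | P s].
  by rewrite openE => s Ps; apply: filterS (Ploc s) => r -[_]; exact.
have cP : closed [set s | P s].
  rewrite -openC openE => s /= nPs; apply: filterS (Ploc s) => r [PrPs _] /=.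
  by move=> /PrPs.
suff : [set s | P s] = setT by move=> PT; have : setT t by []; rewrite -PT.
apply: Tconn.
- by exists t0.
- by exists [set s | P s]; rewrite ?setTI.
- by exists [set s | P s]; rewrite ?setTI.
Qed.

End clopen.

Lemma near_all (T : topologicalType) (P : T -> Prop) (t : T) :
  (forall s, P s) -> \forall s \near t, P s.
Proof. exact: nearW. Qed.

Lemma continuous_near_eq (A B : topologicalType) (f g : A -> B) (a : A) :
  (\forall b \near a, f b = g b) -> {for a, continuous f} ->
  {for a, continuous g}.
Proof.
move=> fg fc N nN.
have nf : nbhs a (f @^-1` N).
  by apply: fc; rewrite (nbhs_singleton fg).
by apply: filterS2 fg nf => b /= ->.
Qed.

(** The local structure of a covering at a sheet [W] over [U]: [s] is the
    section with values in [W], and [V] is the union of the other sheets over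
    [U], so that leaving [W] over [U] is an open condition as well. *)
Record sheet (E B : topologicalType) (p : E -> B) (W : set E) (U : set B)
    (s : B -> E) (V : set E) : Prop := Sheet {
  sheet_open : open W;
  sheet_base_open : open U;
  sheet_other_open : open V;
  sheet_disjoint : forall e, W e -> ~ V e;
  sheet_cover : forall e, U (p e) -> W e \/ V e;
  sheet_proj : forall e, W e -> U (p e);
  sheet_section : forall b, U b -> W (s b);
  sheet_sectionK : forall b, U b -> p (s b) = b;
  sheet_projK : forall e, W e -> s (p e) = e;
  sheet_continuous : forall b, U b -> {for b, continuous s} }.

Section covering.
Variables (E B : topologicalType) (p : E -> B).
Hypothesis covp : covering_map p.

Lemma covering_sheet (e : E) :
  exists W U s V, sheet p W U s V /\ W e.
Proof.
have [pcont /(_ (p e))[U [oU Ue] [S [preU triv SP]]]] := covp.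
have : (p @^-1` U) e by [].
rewrite preU => -[W SW We].
have [oW [Wfun Winj Wsurj] Wopen] := SP W SW.
have ex b : exists e', U b -> W e' /\ p e' = b.
  have [/Wsurj[e' We' <-]|nUb] := pselect (U b); last by exists e.
  by exists e'.
have [s sP] := choice ex.
have sW b : U b -> W (s b) by move=> /sP[].
have ps b : U b -> p (s b) = b by move=> /sP[].
have sp e' : W e' -> s (p e') = e'.
  move=> We'; have Upe' := Wfun _ We'.
  by apply: Winj; rewrite ?inE //; [exact: sW|exact: ps].
exists W, U, s, (\bigcup_(W' in S `\ W) W'); split => //; split => //.
- by apply: bigcup_open => W' [/SP[]].
- move=> e' We' [W' [SW' nW'] W'e']; apply: nW'.
  by apply: (triv _ _ SW' SW); exists e'.
- move=> e' Upe'; have : (p @^-1` U) e' by [].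
  rewrite preU => -[W' SW' W'e'].
  by have [<-|nW'] := pselect (W' = W); [left|right]; [|exists W'].
- move=> b Ub O /=; rewrite nbhsE => -[N [oN Nsb] NO].
  rewrite nbhsE; exists (p @` (N `&` W)); last first.
    move=> _ [e' [Ne' We'] <-] /=; apply: NO.
    by rewrite sp.
  split; first by apply: Wopen => [|? []//]; exact: openI.
  by exists (s b); [split=> //; exact: sW|exact: ps].
Qed.

Lemma covering_continuous : continuous p.
Proof. by case: covp. Qed.

Lemma covering_open : open_map p.
Proof.
move=> O oO; rewrite openE => _ [e Oe <-].
have [W [U [s [V [sh We]]]]] := covering_sheet e.
have Upe := sheet_proj sh We.
have Os : nbhs (p e) (s @^-1` O).
  apply: (sheet_continuous sh Upe); rewrite (sheet_projK sh We).
  exact: open_nbhs_nbhs.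
have : nbhs (p e) U.
  by apply: open_nbhs_nbhs; split => //; exact: sheet_base_open sh.
apply: filterS2 Os => b Osb Ub; exists (s b) => //.
exact: (sheet_sectionK sh Ub).
Qed.

(** Near a common value both maps run in one sheet, where [p] is injective. *)
Lemma covering_lift_near (A : topologicalType) (f g : A -> E) (a : A) :
  {for a, continuous f} -> {for a, continuous g} -> f a = g a ->
  (\forall b \near a, p (f b) = p (g b)) -> \forall b \near a, f b = g b.
Proof.
move=> fc gc fga pfg; have [W [U [s [V [sh Wfa]]]]] := covering_sheet (f a).
have nW : nbhs (f a) W.
  by apply: open_nbhs_nbhs; split => //; exact: (sheet_open sh).
have nWg : nbhs (g a) W by rewrite -fga.
near=> b.
have Wf : W (f b) by near: b; exact: fc.
have Wg : W (g b) by near: b; exact: gc.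
rewrite -(sheet_projK sh Wf) -(sheet_projK sh Wg); congr s.
by near: b.
Unshelve. all: by end_near. Qed.

(** Agreeing and differing are both open: different points over one base point
    have disjoint open neighbourhoods, [W] and [V]. *)
Lemma covering_unique_lift (A : topologicalType) (f g : A -> E) (a : A) :
  connected [set: A] -> continuous f -> continuous g ->
  (forall b, p (f b) = p (g b)) -> f a = g a -> forall b, f b = g b.
Proof.
move=> Aconn fc gc pfg fga.
apply: (connected_local_property (t0 := a)) => // b.
have [fgb|nfg] := pselect (f b = g b).
  apply: filterS (covering_lift_near (fc b) (gc b) fgb _) => //.
  exact: near_all.
have [W [U [s [V [sh Wf]]]]] := covering_sheet (f b).
have nWg : ~ W (g b).
  move=> Wg; apply: nfg; rewrite -(sheet_projK sh Wf) -(sheet_projK sh Wg).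
  by rewrite pfg.
have Vg : V (g b).
  have Ug : U (p (g b)) by rewrite -pfg; exact: (sheet_proj sh Wf).
  by have [] := sheet_cover sh Ug.
have nW : nbhs (f b) W.
  by apply: open_nbhs_nbhs; split => //; exact: (sheet_open sh).
have nV : nbhs (g b) V.
  by apply: open_nbhs_nbhs; split => //; exact: sheet_other_open sh.
near=> c; split=> // fgc; exfalso.
have Wfc : W (f c) by near: c; exact: fc.
apply: (sheet_disjoint sh Wfc); rewrite fgc.
by near: c; exact: gc.
Unshelve. all: by end_near. Qed.

(** The image is open and, as sheets over [U] surject onto [U], closed. *)
Lemma covering_surjective : connected [set: B] -> E -> forall b, exists e, p e = b.
Proof.
move=> Bconn e0; apply: (connected_local_property (t0 := p e0)) => //; last first.
  by exists e0.
move=> b; have [[e pe]|nb] := pselect (exists e, p e = b).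
  have [W [U [s [V [sh We]]]]] := covering_sheet e.
  have Ub : U b by rewrite -pe; exact: (sheet_proj sh We).
  have : nbhs b U.
    by apply: open_nbhs_nbhs; split => //; exact: sheet_base_open sh.
  apply: filterS => c Uc; split => _; first by exists e.
  by exists (s c); exact: (sheet_sectionK sh Uc).
have [_ /(_ b)[U [oU Ub] [S [preU _ SP]]]] := covp.
have : nbhs b U by exact: open_nbhs_nbhs.
apply: filterS => c Uc; split => // -[e pe].
have : (p @^-1` U) e by rewrite /= pe.
rewrite preU => -[W SW We].
by have [_ [_ _ /(_ _ Ub)[e' _ pe']] _] := SP W SW; exists e'.
Qed.

End covering.

Definition locally_connected (T : topologicalType) : Prop :=
  forall (t : T) (O : set T), nbhs t O ->
    exists M : set T, [/\ open_nbhs t M, M `<=` O & connected M].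

Section connected_lift.
Variables (E B : topologicalType) (p : E -> B).
Hypothesis covp : covering_map p.

Lemma sheet_connected (Y : topologicalType) (f : Y -> E) (M : set Y) W U s V y :
  sheet p W U s V -> continuous f -> connected M ->
  (forall z, M z -> U (p (f z))) -> M y -> W (f y) ->
  forall z, M z -> W (f z).
Proof.
move=> sh fc Mconn MU My Wfy z Mz.
have MWV : M `&` f @^-1` W = M `&` ~` (f @^-1` V).
  rewrite eqEsubset; split => t [Mt] /= ft; split => //=.
    by move=> /(sheet_disjoint sh ft).
  by have [] := sheet_cover sh (MU t Mt).
suff : (M `&` f @^-1` W) z by case.
rewrite (Mconn (M `&` f @^-1` W)) //.
- by exists y.
- exists (f @^-1` W) => //; move/continuousP: fc; apply; exact: (sheet_open sh).
- exists (~` (f @^-1` V)) => //; rewrite closedC.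
  by move/continuousP: fc; apply; exact: sheet_other_open sh.
Qed.

(** Joint continuity of a fibrewise lift. On a connected [M] that [f] maps into
    the base of one sheet, continuity at one point of [M] forces [F] into that
    sheet, where [F] is the section composed with [f]; hence the points [y]
    such that [F ^~ y] is continuous at [a] form a clopen set. *)
Lemma covering_lift_continuous (A Y : topologicalType) (F : A -> Y -> E)
    (f : A * Y -> B) (a : A) (y0 : Y) :
  connected [set: Y] -> locally_connected Y ->
  (forall y, {for (a, y), continuous f}) ->
  (\forall b \near a, continuous (F b) /\ forall y, p (F b y) = f (b, y)) ->
  {for a, continuous (F ^~ y0)} ->
  forall y, {for (a, y), continuous (fun z : A * Y => F z.1 z.2)}.
Proof.
move=> Yconn Yloc fc Fl F0.
have [Fac pFa] := nbhs_singleton Fl.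
have key (y : Y) : exists2 M, open_nbhs y M &
    forall z, M z -> {for a, continuous (F ^~ z)} ->
      forall t, M t -> {for (a, t), continuous (fun z : A * Y => F z.1 z.2)}.
  have [W [U [s [V [sh WF]]]]] := covering_sheet covp (F a y).
  have UF : U (f (a, y)) by rewrite -pFa; exact: (sheet_proj sh WF).
  have nU : nbhs (f (a, y)) U.
    by apply: open_nbhs_nbhs; split => //; exact: sheet_base_open sh.
  have [[N O] /= [nN nO] NOU] := fc y U nU.
  have [M [nM MO Mconn]] := Yloc y O nO.
  exists M => // z Mz Fz t Mt.
  have nW : nbhs (F a z) W.
    apply: open_nbhs_nbhs; split; first exact: (sheet_open sh).
    apply: (sheet_connected sh Fac Mconn _ nM.2 WF Mz).
    move=> r Mr; rewrite pFa; apply: (NOU (a, r)); split => /=.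
      exact: (nbhs_singleton nN).
    exact: MO.
  have near_a : \forall b \near a, forall r, M r -> F b r = s (f (b, r)).
    have NaF := Fz W nW.
    apply: filterS3 nN Fl NaF => b Nb [Fbc pFb] WFbz r Mr.
    rewrite -pFb (sheet_projK sh) //.
    apply: (sheet_connected sh Fbc Mconn _ Mz WFbz Mr) => r' Mr'.
    by rewrite pFb; apply: (NOU (b, r')); split => //=; exact: MO.
  have Ut : U (f (a, t)).
    by apply: (NOU (a, t)); split => /=; [exact: (nbhs_singleton nN)|exact: MO].
  have eqF : F a t = s (f (a, t)) by exact: (nbhs_singleton near_a).
  have nM' : nbhs t M by apply: open_nbhs_nbhs; case: nM.
  have cts : {for (a, t), continuous (s \o f)}.
    by apply: continuous_comp; [exact: fc|exact: (sheet_continuous sh Ut)].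
  apply: continuous_near_eq cts.
  suff : nbhs (a, t) [set b : A * Y |
      (forall r, M r -> F b.1 r = s (f (b.1, r))) /\ M b.2].
    by apply: filterS => -[b r] /= [Fb Mr]; rewrite Fb.
  by exists ([set b | forall r, M r -> F b r = s (f (b, r))], M).
move=> y; suff [M [_ My] cM] : exists2 M, open_nbhs y M & forall t, M t ->
    {for (a, t), continuous (fun z : A * Y => F z.1 z.2)} by exact: cM.
have Fat t : {for (a, t), continuous (fun z : A * Y => F z.1 z.2)} ->
    {for a, continuous (F ^~ t)}.
  move=> Fc O /Fc; exact: (cvg_pair cvg_id (cvg_cst t)).
have Fy : forall y, {for a, continuous (F ^~ y)}.
  apply: (connected_local_property (t0 := y0)) => // t.
  have [M oM cM] := key t; have Mt := oM.2.
  apply: filterS (open_nbhs_nbhs oM) => r Mr; split => Fr; apply: Fat.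
    exact: (cM r).
  exact: (cM t).
have [M oM cM] := key y; exists M => // t Mt.
exact: (cM t).
Qed.

End connected_lift.

Lemma locally_path_connected_locally_connected (R : realType)
    (T : topologicalType) : locally_path_connected R T -> locally_connected T.
Proof.
move=> Tlpc t N /Tlpc[V [oV VN [_ Vpath]]]; exists V; split => // B [b Bb].
move=> [C1 oC1 BC1] [C2 cC2 BC2]; rewrite eqEsubset; split => [c|c Vc].
  by rewrite BC1 => -[].
have Vb : V b by move: Bb; rewrite BC1 => -[].
have [f [fc f0 f1 fV]] := Vpath _ _ Vb Vc.
have fI : connected (f @` `[0%R, 1%R]).
  by apply: connected_continuous_connected fc; exact: segment_connected.
have KI : `[0%R, 1%R] (0%R : R) /\ `[0%R, 1%R] (1%R : R).
  by rewrite /= !in_itv /= !lexx ler01.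
have BI C : B = V `&` C -> B `&` f @` `[0%R, 1%R] = f @` `[0%R, 1%R] `&` C.
  move=> BC; rewrite BC eqEsubset; split => d; first by move=> [[_ Cd] fd].
  by move=> [fd Cd]; split => //; split => //; exact: fV.
have /seteqP[_ /(_ c)[]//] : B `&` f @` `[0%R, 1%R] = f @` `[0%R, 1%R].
  apply: fI.
  - by exists b; split => //; exists 0%R; [exact: KI.1|exact: f0].
  - by exists C1 => //; exact: BI.
  - by exists C2 => //; exact: BI.
by exists 1%R; [exact: KI.2|exact: f1].
Qed.

Lemma covering_locally_connected (E B : topologicalType) (p : E -> B) :
  covering_map p -> locally_connected B -> locally_connected E.
Proof.
move=> covp Bloc e N; rewrite nbhsE => -[N' [oN' N'e] N'N].
have [W [U [s [V [sh We]]]]] := covering_sheet covp e.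
have oWN : open (W `&` N') by apply: openI => //; exact: (sheet_open sh).
have nWN : nbhs (p e) (p @` (W `&` N')).
  by apply: open_nbhs_nbhs; split; [exact: covering_open|exists e].
have [M [[oM Me] MWN Mconn]] := Bloc (p e) _ nWN.
have sE b : M b -> exists2 e', (W `&` N') e' & s b = e' /\ p e' = b.
  move=> /MWN[e' [We' Ne'] <-]; exists e' => //.
  by rewrite (sheet_projK sh We').
have MU b : M b -> U b by move=> /MWN[e' [We' _] <-]; exact: (sheet_proj sh We').
exists (s @` M); split.
- split; last by exists (p e) => //; exact: (sheet_projK sh We).
  rewrite (_ : s @` M = W `&` p @^-1` M).
    apply: openI; first exact: (sheet_open sh).
    by move/continuousP: (covering_continuous covp); apply.
  rewrite eqEsubset; split => [_ [b Mb <-]|e' [We' Me']].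
    by have [e' [We' _] [-> pe']] := sE b Mb; split => //=; rewrite pe'.
  by exists (p e') => //; exact: (sheet_projK sh We').
- by move=> _ [b Mb <-]; have [e' [_ Ne'] [-> _]] := sE b Mb; exact: N'N.
- apply: connected_continuous_connected => //.
  apply: continuous_in_subspaceT => b; rewrite inE => Mb.
  exact: (sheet_continuous sh (MU b Mb)).
Qed.

Lemma covering_hausdorff (E B : topologicalType) (p : E -> B) :
  covering_map p -> hausdorff_space B -> hausdorff_space E.
Proof.
move=> covp Bhaus e e' ee'.
have pe : p e = p e'.
  apply: Bhaus => N N' nN nN'.
  have nE : nbhs e (p @^-1` N) by exact: (covering_continuous covp).
  have nE' : nbhs e' (p @^-1` N') by exact: (covering_continuous covp).
  by have [d [Nd N'd]] := ee' _ _ nE nE'; exists (p d).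
have [W [U [s [V [sh We]]]]] := covering_sheet covp e.
have Ue' : U (p e') by rewrite -pe; exact: (sheet_proj sh We).
have nW : nbhs e W.
  by apply: open_nbhs_nbhs; split => //; exact: (sheet_open sh).
have [We'|Ve'] := sheet_cover sh Ue'.
  by rewrite -(sheet_projK sh We) pe (sheet_projK sh We').
have nV : nbhs e' V.
  by apply: open_nbhs_nbhs; split => //; exact: (sheet_other_open sh).
by have [d [/(sheet_disjoint sh)]] := ee' W V nW nV.
Qed.

(** The preimages under [r] of the sheets of [p] are the sheets of [q]. The
    space [T] is any model of the fibre product of [f] and [p], with projections
    [q] and [r], because the group of lifts is such a model without being a
    subspace of a product. *)
Lemma covering_pullback (E B A T : topologicalType) (p : E -> B) (f : A -> B)
    (q : T -> A) (r : T -> E) :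
  covering_map p -> continuous f -> continuous q -> continuous r ->
  (forall t, p (r t) = f (q t)) ->
  (forall t t', q t = q t' -> r t = r t' -> t = t') ->
  (forall a e, p e = f a -> exists t, q t = a /\ r t = e) ->
  (forall t N, nbhs t N -> exists N1 N2, [/\ open_nbhs (q t) N1,
     open_nbhs (r t) N2 & q @^-1` N1 `&` r @^-1` N2 `<=` N]) ->
  covering_map q.
Proof.
move=> covp fc qc rc pr qrI qrS init; split => // a.
have [pc /(_ (f a))[U [oU Ufa] [S [preU triv SP]]]] := covp.
exists (f @^-1` U); first by split => //; move/continuousP: fc; apply.
exists [set r @^-1` W | W in S]; split.
- rewrite eqEsubset; split => t.
    move=> /=; rewrite -pr => Upr; have : (p @^-1` U) (r t) by [].
    by rewrite preU => -[W SW Wrt]; exists (r @^-1` W) => //; exists W.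
  move=> [_ [W SW <-] /= Wrt]; rewrite -pr.
  by suff : (p @^-1` U) (r t) by []; rewrite preU; exists W.
- move=> _ _ [W SW <-] [W' SW' <-] [t [/= Wt W't]]; congr (r @^-1` _).
  by apply: (triv _ _ SW SW'); exists (r t).
- move=> _ [W SW <-]; have [oW [Wfun Winj Wsurj] Wopen] := SP W SW; split.
  + by move/continuousP: rc; apply.
  + split.
    * by move=> t /= Wt; rewrite -pr; exact: Wfun.
    * move=> t t'; rewrite !inE /= => Wt Wt' qtt'; apply: qrI => //.
      by apply: Winj; rewrite ?inE // !pr qtt'.
    * move=> b /= /Wsurj[e We pe]; have [t [qt rt]] := qrS b e pe.
      by exists t => //=; rewrite rt.
  + move=> V oV VW; rewrite openE => _ [t Vt <-].
    have nV : nbhs t V by exact: open_nbhs_nbhs.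
    have [N1 [N2 [[oN1 N1t] [oN2 N2t] NV]]] := init t V nV.
    have nN1 : nbhs (q t) N1 by exact: open_nbhs_nbhs.
    have nN2 : nbhs (q t) (f @^-1` (p @` (N2 `&` W))).
      apply: fc; apply: open_nbhs_nbhs; split.
        by apply: Wopen; [exact: openI|move=> ? []].
      by exists (r t); [split => //; exact: VW|rewrite pr].
    apply: filterS2 nN1 nN2 => b N1b [e [N2e We] pe].
    have [t' [qt' rt']] := qrS b e pe.
    by exists t' => //; apply: NV; split => /=; rewrite ?qt' ?rt'.
Qed.

(** A free and fibrewise transitive group of homeomorphisms over the base turns
    one local section into a full evenly covered neighbourhood. Only the
    translates of a neighbourhood matter, hence no group law on [D]. *)
Lemma covering_of_translations (E B : topologicalType) (p : E -> B)
    (D : set (E -> E)) :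
  continuous p -> open_map p -> (forall b, exists e, p e = b) ->
  (forall d, D d -> open_map d /\ forall e, p (d e) = p e) ->
  (forall e e', p e = p e' -> exists2 d, D d & d e = e') ->
  (forall d d' e, D d -> D d' -> d e = d' e -> d = d') ->
  (forall e, exists2 W, open_nbhs e W & {in W &, injective p}) ->
  covering_map p.
Proof.
move=> pc po psurj Dp Dtrans Dfree ploc; split => // b.
have [e <-] := psurj b; have [W [oW We] Winj] := ploc e.
exists (p @` W); first by split; [exact: po|exists e].
exists [set d @` W | d in D]; split.
- rewrite eqEsubset; split => [e' [w Ww /Dtrans[d Dd dw]]|].
    by exists (d @` W); [exists d|exists w].
  move=> _ [_ [d Dd <-] [w Ww <-]]; exists w => //.
  by rewrite (Dp d Dd).2.
- move=> _ _ [d Dd <-] [d' Dd' <-] [_ [[w Ww <-] [w' Ww' dw]]].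
  have pw : p w = p w' by rewrite -(Dp d Dd).2 -dw (Dp d' Dd').2.
  have ww' : w = w' by apply: Winj; rewrite ?inE.
  by congr (_ @` W); apply: (Dfree d d' w) => //; rewrite {2}ww' dw.
- move=> _ [d Dd <-]; have [od pd] := Dp d Dd; split; first exact: od.
    split.
    * by move=> _ [w Ww <-]; exists w; rewrite ?pd.
    * move=> _ _ /set_mem[w Ww <-] /set_mem[w' Ww' <-]; rewrite !pd => pw.
      by congr d; apply: Winj; rewrite ?inE.
    * by move=> _ [w Ww <-]; exists (d w); rewrite ?pd //; exists w.
  by move=> V oV _; exact: po.
Qed.

(** * Discrete extensions *)

Section continuous_at_combinators.
Variables (A B C : topologicalType) (a : A).

Lemma continuous_at_comp (f : A -> B) (g : B -> C) :
  {for a, continuous f} -> {for f a, continuous g} ->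
  {for a, continuous (fun b => g (f b))}.
Proof. by move=> fc gc; apply: continuous_comp. Qed.

Lemma continuous_at_pair (f : A -> B) (g : A -> C) :
  {for a, continuous f} -> {for a, continuous g} ->
  {for a, continuous (fun b => (f b, g b))}.
Proof. by move=> fc gc; exact: cvg_pair. Qed.

Lemma continuous_at_id : {for a, continuous (@id A)}.
Proof. exact: cvg_id. Qed.

Lemma continuous_at_cst (b : B) : {for a, continuous (fun _ : A => b)}.
Proof. exact: cvg_cst. Qed.

End continuous_at_combinators.

Lemma continuous_at_mulg (A : topologicalType) (G : topGroupType)
    (f g : A -> G) (a : A) :
  {for a, continuous f} -> {for a, continuous g} ->
  {for a, continuous (fun b => f b * g b)%g}.
Proof.
move=> fc gc.
apply: (continuous_at_comp (g := fun z : G * G => z.1 * z.2)%g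
  (continuous_at_pair fc gc)).
exact: mulg_continuous.
Qed.

Lemma continuous_at_invg (A : topologicalType) (G : topGroupType)
    (f : A -> G) (a : A) :
  {for a, continuous f} -> {for a, continuous (fun b => (f b)^-1)%g}.
Proof.
by move=> fc; apply: (continuous_at_comp fc); exact: invg_continuous.
Qed.

Section discrete_extension.
Variables (E G : topGroupType) (p : E -> G).
Hypothesis extp : discrete_extension p.

Lemma ext_continuous : continuous p. Proof. by case: extp => -[]. Qed.

Lemma extM : {morph p : g h / (g * h)%g}. Proof. by case: extp => -[]. Qed.

Lemma ext1 : p 1%g = 1%g.
Proof. by apply: (mulgI (p 1%g)); rewrite -extM !mulg1. Qed.

Lemma extV g : p g^-1%g = (p g)^-1%g.
Proof. by apply: (mulgI (p g)); rewrite -extM !mulgV ext1. Qed.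

Lemma ext_surjective g : exists e, p e = g.
Proof.
by case: extp => _ pT _ _; have : setT g by []; rewrite -pT => -[e _ <-]; exists e.
Qed.

(** Left translations by the kernel permute each fibre simply transitively. If
    [w] and [w'] are close to [e] and have the same image, then [w^-1 * w'] is
    an element of the kernel close to 1, hence 1. *)
Lemma discrete_extension_covering : covering_map p.
Proof.
have [_ _ po [U nU UK]] := extp.
apply: (covering_of_translations (D := [set ( *%g k) | k in p @^-1` [set 1%g]])).
- exact: ext_continuous.
- exact: po.
- exact: ext_surjective.
- move=> _ [k pk <-]; split; last by move=> e; rewrite extM pk mul1g.
  move=> V oV; rewrite (_ : _ @` V = ( *%g k^-1%g) @^-1` V).
    have : continuous (fun e : E => k^-1 * e)%g.
      move=> e; apply: (@continuous_at_mulg _ _ (fun=> k^-1)%g id).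
        exact: cvg_cst.
      exact: cvg_id.
    by move/continuousP; apply.
  rewrite eqEsubset; split => [_ [v Vv <-] /=|v /= Vv]; first by rewrite mulKg.
  by exists (k^-1 * v)%g => //; rewrite mulVKg.
- move=> e e' pe; exists ( *%g (e' * e^-1)%g); last by rewrite mulgVK.
  by exists (e' * e^-1)%g => //=; rewrite extM extV pe mulgV.
- by move=> _ _ e [k _ <-] [k' _ <-] /mulIg ->.
- move=> e; have : {for (e, e), continuous (fun z : E * E => z.1^-1 * z.2)%g}.
    apply: continuous_at_mulg; last exact: cvg_snd.
    by apply: continuous_at_invg; exact: cvg_fst.
  move=> /(_ U); rewrite mulVg => /(_ nU)[[V1 V2] /= [nV1 nV2] VU].
  have : nbhs e (V1 `&` V2) by exact: filterI.
  rewrite nbhsE => -[V oV VV]; exists V => // w w'.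
  rewrite !inE => /VV[V1w _] /VV[_ V2w'] pw.
  have : [set 1%g] (w^-1 * w')%g.
    rewrite -UK; split; first exact: (VU (w, w')).
    by rewrite /= extM extV pw mulVg.
  by move/(congr1 ( *%g w)); rewrite mulVKg mulg1 => ->.
Qed.

Section path_lifting.
Local Open Scope ring_scope.
Variables (R : realType) (gamma : R -> G).
Hypothesis gammac : continuous gamma.

Let stop (T t : R) : R := Num.max (Num.min t T) 0.

Let stop_continuous T : continuous (stop T).
Proof.
move=> t; apply: (@continuous_at_comp _ _ _ t (Num.min^~ T) (Num.max^~ 0)).
  by apply: continuous_min; [exact: cvg_id|exact: cvg_cst].
by apply: continuous_max; [exact: cvg_id|exact: cvg_cst].
Qed.

(** The times [T] such that the path stopped at [T] lifts form a clopen set: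
    over a short enough interval of times, changing [T] multiplies the path by
    elements close to 1, which lift through the local section at 1. *)
Lemma ext_path_lift (e : E) : p e = gamma 0 ->
  exists lambda : R -> E, [/\ continuous lambda, lambda 0 = e &
    forall t, p (lambda t) = gamma (Num.max (Num.min t 1) 0)].
Proof.
move=> pe.
pose P (T : R) := exists lambda : R -> E, [/\ continuous lambda, lambda 0 = e &
    forall t, p (lambda t) = gamma (stop T t)].
apply: (connected_local_property (P := P) (t0 := 0)); last 1 first.
- exists (fun=> e); split => // [t|t]; first exact: cvg_cst.
  rewrite pe /stop; congr gamma; apply/esym/max_idPr.
  by rewrite ge_min lexx orbT.
- exact/connected_intervalP.
move=> t.
have [W [U [s [V [sh W1]]]]] := covering_sheet discrete_extension_covering 1%g.
have U1 : U 1%g by rewrite -ext1; exact: (sheet_proj sh W1).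
have nU : nbhs (1%g : G) U.
  by apply: open_nbhs_nbhs; split => //; exact: (sheet_base_open sh).
pose gamma' u := gamma (Num.max u 0).
have gammac' : continuous gamma'.
  move=> u; apply: (@continuous_at_comp _ _ _ u (Num.max^~ 0)); last exact: gammac.
  by apply: continuous_max; [exact: cvg_id|exact: cvg_cst].
have : {for (t, t), continuous (fun z : R * R => gamma' z.1 * (gamma' z.2)^-1)%g}.
  apply: continuous_at_mulg.
    by apply: continuous_at_comp; [exact: cvg_fst|exact: gammac'].
  apply: continuous_at_invg.
  by apply: continuous_at_comp; [exact: cvg_snd|exact: gammac'].
move=> /(_ U); rewrite /= mulgV => /(_ nU)[[V1 V2] /= [nV1 nV2] VU].
have : nbhs t (V1 `&` V2) by exact: filterI.
move=> /nbhs_ballP[d /= d0 dV].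
have window u v : ball t d u -> ball t d v -> U (gamma' u * (gamma' v)^-1)%g.
  by move=> /dV[V1u _] /dV[_ V2v]; exact: (VU (u, v)).
have extend u v : ball t d u -> ball t d v -> P u -> P v.
  move=> tu tv [l [lc l0 pl]].
  (* For every [r] the two stopped times agree or both lie in the ball. *)
  pose g r := (gamma (stop v r) * (gamma (stop u r))^-1)%g.
  have Ug r : U (g r).
    have [ru|ur] := leP r (Num.min u v).
      move: ru; rewrite le_min => /andP[ru rv].
      by rewrite /g /stop !min_l // mulgV.
    have near_t w x : x < r -> ball t d x -> ball t d w -> ball t d (Num.min r w).
      rewrite /ball /= !ltr_distl => xr /andP[x1 x2] /andP[w1 w2].
      by case: (leP r w) => rw; apply/andP; split; lra.
    by apply: window; move: ur; rewrite gt_min => /orP[] ur;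
      apply: near_t ur _ _.
  have gc : continuous g.
    move=> r; apply: (@continuous_at_mulg _ _ (gamma \o stop v)
      (fun r => (gamma (stop u r))^-1)%g).
      by apply: continuous_at_comp; [exact: stop_continuous|exact: gammac].
    apply: continuous_at_invg.
    by apply: continuous_at_comp; [exact: stop_continuous|exact: gammac].
  exists (fun r => s (g r) * l r)%g; split.
  - move=> r; apply: (@continuous_at_mulg _ _ (s \o g) l); last exact: lc.
    by apply: continuous_at_comp; [exact: gc|exact: (sheet_continuous sh (Ug r))].
  - suff -> : g 0 = 1%g by rewrite -ext1 (sheet_projK sh W1) mul1g.
    have stop0 w : stop w 0 = 0 by apply/max_idPr; rewrite ge_min lexx.
    by rewrite /g !stop0 mulgV.
  - by move=> r; rewrite extM (sheet_sectionK sh (Ug r)) pl /g mulgVK.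
apply: filterS (nbhsx_ballx t d d0) => u tu.
by split; apply: extend => //; exact: ballxx.
Qed.

End path_lifting.

End discrete_extension.

Lemma covering_discrete_extension (E G : topGroupType) (p : E -> G) :
  covering_map p -> {morph p : g h / (g * h)%g} -> (forall g, exists e, p e = g) ->
  discrete_extension p.
Proof.
move=> covp pM pS; split.
- by split => //; exact: covering_continuous.
- by rewrite eqEsubset; split => // g _; have [e eg] := pS g; exists e.
- exact: covering_open.
have p1 : p 1%g = 1%g by apply: (mulgI (p 1%g)); rewrite -pM !mulg1.
have [W [U [s [V [sh W1]]]]] := covering_sheet covp 1%g.
exists W; first by apply: open_nbhs_nbhs; split => //; exact: (sheet_open sh).
rewrite eqEsubset; split => [e [We /= pe]|_ ->]; last by split.
by rewrite /= -(sheet_projK sh We) pe -p1 (sheet_projK sh W1).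
Qed.

(** * Groups of lifts *)

Lemma homeo_comp (A B C : topologicalType) (f : A -> B) (g : B -> C) :
  homeo f -> homeo g -> homeo (g \o f).
Proof.
move=> [fc [f' f'c [fK f'K]]] [gc [g' g'c [gK g'K]]]; split.
  by move=> a; apply: continuous_comp; [exact: fc|exact: gc].
exists (f' \o g'); last by split; exact: can_comp.
by move=> a; apply: continuous_comp; [exact: g'c|exact: f'c].
Qed.

Lemma homeo_open (A B : topologicalType) (f : A -> B) : homeo f -> open_map f.
Proof.
move=> [fc [g gc [fK gK]]] V oV; rewrite (_ : f @` V = g @^-1` V).
  by move/continuousP: gc; apply.
rewrite eqEsubset; split => [_ [v Vv <-]|b Vgb]; first by rewrite /= fK.
by exists (g b).
Qed.

Lemma open_map_times (A B C : topologicalType) (f : A -> B) :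
  open_map f -> open_map (fun z : A * C => (f z.1, z.2)).
Proof.
move=> fo V oV; rewrite openE => _ [[a c] Vac <-].
have [[N M] /= [nN nM] NMV] : nbhs (a, c) V by exact: open_nbhs_nbhs.
move: nN; rewrite nbhsE => -[N' [oN' N'a] N'N].
exists (f @` N', M) => /=.
  by split => //; apply: open_nbhs_nbhs; split; [exact: fo|exists a].
move=> [_ m] /= [[n N'n <-] Mm]; exists (n, m) => //.
by apply: NMV; split => //=; exact: N'N.
Qed.

Lemma quotient_map_factor (S T Y : topologicalType) (q : S -> T) (f : S -> Y) :
  quotient_map q -> continuous f -> (forall s s', q s = q s' -> f s = f s') ->
  exists2 g : T -> Y, continuous g & forall s, g (q s) = f s.
Proof.
move=> [qc qT qo] fc qf.
have ex t : exists s, q s = t.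
  by have : setT t by []; rewrite -qT => -[s _ <-]; exists s.
have [r qr] := choice ex.
have gE s : f (r (q s)) = f s by apply: qf.
exists (f \o r) => //; apply/continuousP => V oV; apply: qo.
rewrite (_ : _ @^-1` _ = f @^-1` V); first by move/continuousP: fc; apply.
by rewrite eqEsubset; split => s /=; rewrite gE.
Qed.

Section polar.
Variables (R : realType) (G : lieGroupType R) (X : topologicalType).
Variables (act : G -> X -> X) (x : orbit_space act -> X).
Hypotheses (polX : polar_space act) (secx : polar_section x).
Local Notation Q := (orbit_space act).
Local Notation H := (isotropy x).

Lemma act_continuous : continuous (fun z : G * X => act z.1 z.2).
Proof. by case: polX => -[]. Qed.

Lemma act1 y : act 1%g y = y.
Proof. by case: polX => -[]. Qed.

Lemma actM g h y : act (g * h)%g y = act g (act h y).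
Proof. by case: polX => -[]. Qed.

Lemma act_faithful g h : (forall y, act g y = act h y) -> g = h.
Proof.
case: polX => -[_ _ _ faith] _ _ _ gh.
suff : (h^-1 * g = 1)%g by move/(congr1 ( *%g h)); rewrite mulVKg mulg1.
by apply: faith => y; rewrite actM gh -actM mulVg act1.
Qed.

Lemma actK g : cancel (act g) (act g^-1%g).
Proof. by move=> y; rewrite -actM mulVg act1. Qed.

Lemma orbit_inhabited : exists q : Q, True.
Proof. by case: polX => _ _ [[[q _] _] _] _; exists q. Qed.

Lemma orbit_pi_act g y : orbit_pi act (act g y) = orbit_pi act y.
Proof.
apply/eqmodP/asboolP/rst_sym/rst_step.
by exists g.
Qed.

Lemma section_continuous : continuous x. Proof. by case: secx. Qed.

Lemma sectionK : cancel x (orbit_pi act). Proof. by case: secx. Qed.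

Lemma phi_quotient : quotient_map (phi x). Proof. by case: secx. Qed.

Lemma phi_surjective y : exists z, phi x z = y.
Proof.
have [_ phiT _] := phi_quotient.
by have : setT y by []; rewrite -phiT => -[z _ <-]; exists z.
Qed.

Lemma phi_eq y z : phi x y = phi x z ->
  y.2 = z.2 /\ act (y.1^-1 * z.1)%g (x y.2) = x y.2.
Proof.
move=> yz; have yz2 : y.2 = z.2.
  have := congr1 (orbit_pi act) yz.
  by rewrite /phi !orbit_pi_act !sectionK.
split => //; rewrite actM yz2.
by move: yz; rewrite /phi yz2 => <-; rewrite actK.
Qed.

Section covering.
Variable P : polcov x.
Local Notation p := (@pc_proj _ _ _ _ _ P).

Lemma pc_covering : covering_map p. Proof. by case: (pc_polar P). Qed.

Lemma pc_connected : connected [set: P]. Proof. by case: (pc_polar P). Qed.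

Lemma pc_surjective b : exists y, p y = b.
Proof.
have [q _] := orbit_inhabited.
apply: (covering_surjective pc_covering _ (pc_lift P q)).
by case: polX => _ [].
Qed.

Lemma lifts_action_unique g h f :
  lifts_action act p g f -> lifts_action act p h f -> g = h.
Proof.
move=> [_ fg] [_ fh]; apply: act_faithful => b.
by have [y <-] := pc_surjective b; rewrite -fg fh.
Qed.

Lemma lifts_action_eq g f f' y :
  lifts_action act p g f -> lifts_action act p g f' -> f y = f' y -> f = f'.
Proof.
move=> [[fc _] fg] [[f'c _] f'g] ff'; apply: funext.
apply: (covering_unique_lift pc_covering pc_connected fc f'c _ ff').
by move=> b; rewrite fg f'g.
Qed.

(** A polar covering has some lift of [g]; being Galois, it has a deck
    transformation that corrects the value at [y]. *)
Lemma lifts_action_exists g y z : p z = act g (p y) ->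
  exists2 f, lifts_action act p g f & f y = z.
Proof.
move=> pz; have [_ _ gal /(_ g)[f [fh fg]]] := pc_polar P.
have [d [dh pd dz]] : exists d, [/\ homeo d, forall w, p (d w) = p w & d (f y) = z].
  by apply: gal; rewrite fg pz.
exists (d \o f) => //; split; first exact: homeo_comp.
by move=> w; rewrite /= pd fg.
Qed.

(** The part of the data of the group of all lifts that does not involve its
    group law: the continuity of the group law is deduced from it. *)
Definition lift_group (K : topologicalType) (pr : K -> G) (a : K -> P -> P) :=
  [/\ injective a, range a = [set g' | exists g, lifts_action act p g g'],
      forall k y, p (a k y) = act (pr k) (p y), covering_map pr &
      continuous (fun z : K * P => a z.1 z.2)].

Section lift_group.
Variables (K : topologicalType) (pr : K -> G) (a : K -> P -> P).
Hypothesis Ka : lift_group pr a.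

Lemma lift_groupP k : lifts_action act p (pr k) (a k).
Proof.
have [_ aT pa _ _] := Ka.
have : range a (a k) by exists k.
by rewrite aT => -[g [ah _]]; split => // y; exact: pa.
Qed.

Lemma lift_group_eq k l y : pr k = pr l -> a k y = a l y -> k = l.
Proof.
have [aI _ _ _ _] := Ka; move=> kl akl; apply: aI.
by apply: (lifts_action_eq (lift_groupP k) _ akl); rewrite kl; exact: lift_groupP.
Qed.

Lemma lift_group_exists g y z : p z = act g (p y) ->
  exists k, pr k = g /\ a k y = z.
Proof.
have [_ aT _ _ _] := Ka; move=> /lifts_action_exists[f fg fy].
have : [set g' | exists g, lifts_action act p g g'] f by exists g.
rewrite -aT => -[k _ akf]; exists k; rewrite akf; split => //.
by apply: (lifts_action_unique (f := f)) => //; rewrite -akf; exact: lift_groupP.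
Qed.

(** One moving point [y] detects convergence in a group of lifts. Near [t], the
    local section of [pr] through [f t] gives another lift of [pr (f b)]; the two
    lifts send [y b] into one sheet of [P], hence to the same point, hence they
    are equal. *)
Lemma lift_group_continuous (A : topologicalType) (f : A -> K) (y : A -> P) t :
  {for t, continuous (pr \o f)} -> {for t, continuous y} ->
  {for t, continuous (fun b => a (f b) (y b))} -> {for t, continuous f}.
Proof.
have [_ _ pa Kcov ac] := Ka; move=> fc yc afc.
have [W [U [s [V [sh Wf]]]]] := covering_sheet Kcov (f t).
have Uf : U (pr (f t)) by exact: (sheet_proj sh Wf).
have nU : nbhs (pr (f t)) U.
  by apply: open_nbhs_nbhs; split => //; exact: (sheet_base_open sh).
have nfU : nbhs t ((pr \o f) @^-1` U) by exact: fc.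
have sfc : {for t, continuous (fun b => s (pr (f b)))}.
  by apply: continuous_at_comp fc _; exact: (sheet_continuous sh Uf).
have sfy : {for t, continuous (fun b => a (s (pr (f b))) (y b))}.
  apply: (continuous_at_comp (g := fun z : K * P => a z.1 z.2)
    (continuous_at_pair sfc yc)).
  exact: ac.
apply: (continuous_near_eq _ sfc).
have afE : \forall b \near t, a (s (pr (f b))) (y b) = a (f b) (y b).
  apply: (covering_lift_near pc_covering sfy afc).
    by rewrite (sheet_projK sh Wf).
  apply: filterS nfU => b /= Ub.
  by rewrite !pa (sheet_sectionK sh Ub).
apply: filterS2 nfU afE => b /= Ub; apply: lift_group_eq.
by rewrite (sheet_sectionK sh Ub).
Qed.

(** Let [V] have an open preimage. Inside a sheet, [p] identifies [V] with its
    image in [X], and the preimage of this image by [phi x] is the projection to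
    [G * Q] of the preimage of [V], hence open; now [phi x] is a quotient map. *)
Lemma lift_group_quotient :
  quotient_map (fun z : K * Q => a z.1 (pc_lift P z.2)).
Proof.
have [_ _ pa Kcov ac] := Ka.
have qc : continuous (fun z : K * Q => a z.1 (pc_lift P z.2)).
  move=> z; apply: (@continuous_at_comp _ _ _ z
    (fun z => (z.1, pc_lift P z.2)) (fun z : K * P => a z.1 z.2)); last exact: ac.
  apply: continuous_at_pair; first exact: cvg_fst.
  by apply: continuous_at_comp; [exact: cvg_snd|exact: pc_lift_continuous].
have qS y : exists z : K * Q, a z.1 (pc_lift P z.2) = y.
  have [[g q] gq] := phi_surjective (p y).
  have py : p y = act g (p (pc_lift P q)) by rewrite pc_liftP -gq.
  by have [k [_ aky]] := lift_group_exists py; exists (k, q).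
split => //.
  rewrite eqEsubset; split => // y _; have [z zy] := qS y.
  by exists z.
move=> V oV; rewrite openE => y Vy.
have [W [U [s [V' [sh Wy]]]]] := covering_sheet pc_covering y.
pose N := p @` (V `&` W).
have oN : open N.
  have [_ _ phiQ] := phi_quotient; apply: phiQ.
  rewrite (_ : _ @^-1` N = (fun z : K * Q => (pr z.1, z.2)) @`
      ((fun z : K * Q => a z.1 (pc_lift P z.2)) @^-1` (V `&` W))).
    apply: (open_map_times (covering_open Kcov)).
    rewrite preimage_setI; apply: openI => //.
    by move/continuousP: qc; apply; exact: (sheet_open sh).
  rewrite eqEsubset; split => [[g q] [w [Vw Ww] pw]|].
    have pw' : p w = act g (p (pc_lift P q)) by rewrite pc_liftP pw.
    have [k [prk aky]] := lift_group_exists pw'.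
    by exists (k, q); rewrite /= ?aky ?prk.
  move=> _ [[k q] /= [Va Wa] <-]; exists (a k (pc_lift P q)) => //.
  by rewrite pa pc_liftP.
have nN : nbhs y (p @^-1` N).
  apply: (covering_continuous pc_covering); apply: open_nbhs_nbhs.
  by split => //; exists y.
have nW : nbhs y W.
  by apply: open_nbhs_nbhs; split => //; exact: (sheet_open sh).
apply: filterS2 nN nW => w [v [Vv Wv] pv] Ww.
by rewrite -(sheet_projK sh Ww) -pv (sheet_projK sh Wv).
Qed.

End lift_group.

End covering.

End polar.

(** * The group of lifts of a polar covering *)

Section lift_carrier.
Variables (R : realType) (G : lieGroupType R) (X : topologicalType).
Variables (act : G -> X -> X) (x : orbit_space act -> X) (P : polcov x).

Record lifting := Lifting {
  lifting_fun :> P -> P;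
  liftingP : exists g, lifts_action act (@pc_proj _ _ _ _ _ P) g lifting_fun }.

Lemma lifting_eq (f g : lifting) : lifting_fun f = lifting_fun g -> f = g.
Proof.
case: f g => f fP [g gP] /= fg; case: g / fg gP => gP.
by congr Lifting; exact: Prop_irrelevance.
Qed.

End lift_carrier.

(** The proofs are parameters of the type because the group law and the
    topology depend on them. *)
Definition lift_space (R : realType) (G : lieGroupType R)
    (X : topologicalType) (act : G -> X -> X) (x : orbit_space act -> X)
    (polX : polar_space act) (secx : polar_section x) (P : polcov x) : Type :=
  lifting P.

Section lift_space.
Variables (R : realType) (G : lieGroupType R) (X : topologicalType).
Variables (act : G -> X -> X) (x : orbit_space act -> X).
Hypotheses (polX : polar_space act) (secx : polar_section x).
Variable P : polcov x.
Local Notation Q := (orbit_space act).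
Local Notation p := (@pc_proj _ _ _ _ _ P).
Local Notation K := (lift_space polX secx P).

HB.instance Definition _ := gen_eqMixin K.
HB.instance Definition _ := gen_choiceMixin K.

Definition lift_fun (f : K) : P -> P := lifting_fun f.

Definition lift_proj (f : K) : G := projT1 (cid (liftingP f)).

Lemma lift_projP (f : K) : lifts_action act p (lift_proj f) (lift_fun f).
Proof. exact: projT2 (cid (liftingP f)). Qed.

Lemma lift_eq (f g : K) : lift_fun f =1 lift_fun g -> f = g.
Proof. by move=> fg; apply: lifting_eq; apply: funext. Qed.

Lemma lift_spaceE (f : K) y : p (lift_fun f y) = act (lift_proj f) (p y).
Proof. by case: (lift_projP f). Qed.

Lemma lift_fun_continuous (f : K) : continuous (lift_fun f).
Proof. by case: (lift_projP f) => -[]. Qed.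

Lemma lift_proj_unique (f : K) g :
  lifts_action act p g (lift_fun f) -> lift_proj f = g.
Proof. exact: lifts_action_unique (lift_projP f). Qed.

Definition lift_of (g : G) (f : P -> P) (fg : lifts_action act p g f) : K :=
  Lifting (ex_intro _ g fg).

Lemma lift_inv_ex (f : K) : exists g : K,
  (forall y, lift_fun g (lift_fun f y) = y) /\
  (forall y, lift_fun f (lift_fun g y) = y).
Proof.
have [[fc [g gc [fK gK]]] pf] := lift_projP f.
have gP : lifts_action act p (lift_proj f)^-1%g g.
  split; first by split => //; exists (lift_fun f).
  by move=> y; rewrite -{2}(gK y) pf (actK polX).
by exists (lift_of gP).
Qed.

Lemma lift_comp_lifts (f g : K) :
  lifts_action act p (lift_proj f * lift_proj g)%g (lift_fun f \o lift_fun g).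
Proof.
have [fh pf] := lift_projP f; have [gh pg] := lift_projP g.
by split; [exact: homeo_comp|move=> y; rewrite /= pf pg (actM polX)].
Qed.

Lemma lift_id_lifts : lifts_action act p 1%g id.
Proof.
split; last by move=> y; rewrite (act1 polX).
by split => [y|]; [exact: cvg_id|exists id => // y; exact: cvg_id].
Qed.

Definition lift_mul (f g : K) : K := lift_of (lift_comp_lifts f g).
Definition lift_one : K := lift_of lift_id_lifts.
Definition lift_inv (f : K) : K := projT1 (cid (lift_inv_ex f)).

Lemma lift_mulA : associative lift_mul.
Proof. by move=> f g h; exact: lift_eq. Qed.
Lemma lift_mul1f : left_id lift_one lift_mul.
Proof. by move=> f; exact: lift_eq. Qed.
Lemma lift_mulf1 : right_id lift_one lift_mul.
Proof. by move=> f; exact: lift_eq. Qed.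
Lemma lift_mulVf : left_inverse lift_one lift_inv lift_mul.
Proof.
move=> f; apply: lift_eq => y.
by have [fK _] := projT2 (cid (lift_inv_ex f)); exact: fK.
Qed.
Lemma lift_mulfV : right_inverse lift_one lift_inv lift_mul.
Proof.
move=> f; apply: lift_eq => y.
by have [_ fK] := projT2 (cid (lift_inv_ex f)); exact: fK.
Qed.

HB.instance Definition _ :=
  monoid.isGroup.Build K lift_mulA lift_mul1f lift_mulf1 lift_mulVf lift_mulfV.

Lemma lift_funM (f g : K) y : lift_fun (f * g)%g y = lift_fun f (lift_fun g y).
Proof. by []. Qed.

Lemma lift_projM : {morph lift_proj : f g / (f * g)%g}.
Proof. by move=> f g; apply: lift_proj_unique; exact: lift_comp_lifts. Qed.

Definition base_orbit : Q := projT1 (cid (orbit_inhabited polX)).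
Definition base_lift : P := pc_lift P base_orbit.

(** A lift is determined by the element that it lifts and by its value at the
    base point; this identifies [K] with the pullback of the covering along the
    orbit map of the base point. *)
Definition lift_eval (f : K) : G * P := (lift_proj f, lift_fun f base_lift).

HB.instance Definition _ := Topological.copy K (initial_topology lift_eval).

Lemma lift_eval_continuous : continuous lift_eval.
Proof. exact: initial_continuous. Qed.

Lemma lift_proj_continuous : continuous lift_proj.
Proof.
move=> f; apply: (continuous_at_comp (g := fst) (@lift_eval_continuous f)).
exact: cvg_fst.
Qed.

Lemma lift_base_continuous : continuous (lift_fun^~ base_lift).
Proof.
move=> f; apply: (continuous_at_comp (g := snd) (@lift_eval_continuous f)).
exact: cvg_snd.
Qed.

Lemma lift_proj_covering : covering_map lift_proj.
Proof.
apply: (@covering_pullback P X G K p (fun g => act g (p base_lift)) lift_proj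
  (lift_fun^~ base_lift)).
- exact: pc_covering.
- move=> g; apply: (@continuous_at_comp _ _ _ g (fun g => (g, p base_lift))
    (fun z : G * X => act z.1 z.2)); last exact: (act_continuous polX).
  by apply: continuous_at_pair; [exact: cvg_id|exact: cvg_cst].
- exact: lift_proj_continuous.
- exact: lift_base_continuous.
- by move=> f; rewrite lift_spaceE.
- move=> f g fg fgb; apply: lifting_eq.
  apply: (lifts_action_eq (lift_projP f) _ fgb).
  by rewrite fg; exact: lift_projP.
- move=> g y /lifts_action_exists[f fg fy]; exists (lift_of fg); split => //.
  exact: lift_proj_unique.
- move=> f N [_ [[V oV <-] Vf] VN].
  have [[N1 N2] /= [+ +] NV] : nbhs (lift_eval f) V by exact: open_nbhs_nbhs.
  rewrite !nbhsE /= => -[M1 oM1 MN1] [M2 oM2 MN2]; exists M1, M2; split => //.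
  by move=> g [M1g M2g]; apply: VN; apply: NV; split; [exact: MN1|exact: MN2].
Qed.

(** At the base point the action is the second component of [lift_eval], which
    is continuous by the choice of the topology; this propagates to all of [P]. *)
Lemma lift_space_lift_group : lift_group lift_proj lift_fun.
Proof.
split.
- by move=> f g fg; exact: lifting_eq.
- rewrite eqEsubset; split => [_ [f _ <-]|f [g fg]]; last by exists (lift_of fg).
  by exists (lift_proj f); exact: lift_projP.
- exact: lift_spaceE.
- exact: lift_proj_covering.
move=> [f y].
apply: (covering_lift_continuous (pc_covering P) (F := lift_fun)
  (f := fun z : K * P => act (lift_proj z.1) (p z.2)) (y0 := base_lift)).
- exact: pc_connected.
- apply: (covering_locally_connected (pc_covering P)).
  apply: (@locally_path_connected_locally_connected R).
  by case: polX => _ [].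
- move=> z; apply: (@continuous_at_comp _ _ _ (f, z)
    (fun z : K * P => (lift_proj z.1, p z.2)) (fun z : G * X => act z.1 z.2)).
    apply: continuous_at_pair.
      by apply: continuous_at_comp; [exact: cvg_fst|exact: lift_proj_continuous].
    apply: continuous_at_comp; first exact: cvg_snd.
    exact: (covering_continuous (pc_covering P)).
  exact: (act_continuous polX).
- apply: (@near_all K) => g.
  split; first exact: lift_fun_continuous.
  by move=> z; rewrite lift_spaceE.
- exact: lift_base_continuous.
Qed.

Let Ka := lift_space_lift_group.

Lemma lift_act_continuous (A : topologicalType) (f : A -> K) (y : A -> P) t :
  {for t, continuous f} -> {for t, continuous y} ->
  {for t, continuous (fun b => lift_fun (f b) (y b))}.
Proof.
move=> fc yc; apply: (continuous_at_comp (g := fun z : K * P => lift_fun z.1 z.2)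
  (continuous_at_pair fc yc)).
by have [_ _ _ _ ac] := Ka; exact: ac.
Qed.

Lemma lift_mul_continuous : continuous (fun z : K * K => z.1 * z.2)%g.
Proof.
move=> z; apply: (lift_group_continuous Ka
  (f := fun z : K * K => (z.1 * z.2)%g) (y := fun=> base_lift)).
- rewrite (_ : _ \o _ = fun z : K * K => lift_proj z.1 * lift_proj z.2)%g.
    apply: continuous_at_mulg.
      by apply: continuous_at_comp; [exact: cvg_fst|exact: lift_proj_continuous].
    by apply: continuous_at_comp; [exact: cvg_snd|exact: lift_proj_continuous].
  by apply: funext => w /=; rewrite lift_projM.
- exact: cvg_cst.
- apply: (@lift_act_continuous _ fst (fun z : K * K => lift_fun z.2 base_lift)).
    exact: cvg_fst.
  apply: (continuous_at_comp (f := snd) (g := lift_fun^~ base_lift)).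
    exact: cvg_snd.
  exact: lift_base_continuous.
Qed.

Lemma lift_inv_continuous : continuous (fun f : K => f^-1)%g.
Proof.
(* At the moving point [lift_fun g base_lift] the inverse of [g] takes the
   constant value [base_lift]. *)
move=> f; apply: (lift_group_continuous Ka (f := fun f : K => (f^-1)%g)
  (y := lift_fun^~ base_lift)).
- rewrite (_ : _ \o _ = fun f : K => (lift_proj f)^-1)%g.
    by apply: (@continuous_at_invg _ _ lift_proj); exact: lift_proj_continuous.
  apply: funext => g /=; apply: (mulgI (lift_proj g)).
  rewrite -lift_projM !mulgV; apply: lift_proj_unique; exact: lift_id_lifts.
- exact: lift_base_continuous.
- apply: (continuous_near_eq (f := fun=> base_lift)); last first.
    exact: continuous_at_cst.
  apply: (@near_all K) => g.
  by rewrite -lift_funM mulVg.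
Qed.

HB.instance Definition _ :=
  isTopologicalGroup.Build K lift_mul_continuous lift_inv_continuous.

Lemma lift_hausdorff : hausdorff_space K.
Proof.
apply: (covering_hausdorff lift_proj_covering).
exact: (@lie_hausdorff R).
Qed.

End lift_space.

(** * Lie group structure on the total space of a covering *)

Section smooth_local.
Local Open Scope ring_scope.
Variables (R : realType) (V W : normedModType R).

Lemma near_eq_differentiable (f g : V -> W) (v : V) :
  (\forall w \near v, f w = g w) -> differentiable f v -> differentiable g v.
Proof.
move=> fg df; have [dfc fE] := (diff_locallyP v f).1 df.
have gE : g \o shift v = cst (g v) + 'd f v +o_ (0 : V) id.
  apply/eqaddoP => e e0.
  have /eqaddoP /(_ e e0) fo := fE.
  have fg0 : \forall w \near (0 : V), f (w + v) = g (w + v).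
    by move: fg; rewrite (near_shift 0) => fg; apply: filterS fg => w /=; rewrite subr0.
  apply: filterS2 fo fg0 => w /=.
  by rewrite !fctE /= => + <-; rewrite (nbhs_singleton fg).
apply/diff_locallyP.
have -> : 'd g v = 'd f v :> (V -> W) by exact: diff_unique.
by split.
Qed.

(** Differentiability and derivatives at a point only depend on the germ. *)
Lemma class_C_local (k : nat) (U U' : set V) (f g : V -> W) :
  open U' -> U' `<=` U -> (forall v, U' v -> f v = g v) ->
  class_C k U f -> class_C k U' g.
Proof.
elim: k f g => [|k IH] f g oU' UU' fg /=.
  move=> fc v Uv; apply: (continuous_near_eq _ (fc v (UU' v Uv))).
  by apply: filterS (open_nbhs_nbhs (conj oU' Uv)) => w; exact: fg.
have near_fg v : U' v -> \forall w \near v, f w = g w.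
  by move=> U'v; apply: filterS (open_nbhs_nbhs (conj oU' U'v)) => w; exact: fg.
move=> [df dvf]; split => [v U'v|v].
  by apply: near_eq_differentiable (near_fg v U'v) (df v (UU' v U'v)).
apply: IH (dvf v) => // w U'w.
by apply: near_eq_derive; exact: near_fg.
Qed.

Lemma smooth_local (U U' : set V) (f g : V -> W) :
  open U' -> U' `<=` U -> (forall v, U' v -> f v = g v) ->
  smooth U f -> smooth U' g.
Proof. by move=> oU' UU' fg fs k; exact: class_C_local (fs k). Qed.

End smooth_local.

Section chart.
Variables (R : realType) (T : topologicalType) (n : nat) (c : chart R T n).

Lemma chart_inv_continuous_at v : chart_cod c v ->
  {for v, continuous (chart_inv c)}.
Proof.
move=> cv; have := @chart_inv_continuous _ _ _ c.
rewrite continuous_open_subspace; last exact: chart_cod_open.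
by apply; rewrite inE.
Qed.

Lemma chart_continuous_at t : chart_dom c t -> {for t, continuous c}.
Proof.
move=> ct; have := @chart_continuous _ _ _ c.
rewrite continuous_open_subspace; last exact: chart_dom_open.
by apply; rewrite inE.
Qed.

Lemma open_preimage_chart_inv (U : set T) : open U ->
  open (chart_cod c `&` chart_inv c @^-1` U).
Proof.
move=> oU; rewrite openE => v [cv Uv]; apply: filterI.
  by apply: open_nbhs_nbhs; split => //; exact: chart_cod_open.
by apply: chart_inv_continuous_at => //; exact: open_nbhs_nbhs.
Qed.

End chart.

Section lift_chart.
Variables (R : realType) (E B : topologicalType) (p : E -> B) (n : nat).
Variables (W : set E) (U : set B) (s : B -> E) (V : set E).
Hypotheses (pc : continuous p) (sh : sheet p W U s V).
Variable c : chart R B n.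

Let dom := W `&` p @^-1` chart_dom c.
Let cod := chart_cod c `&` chart_inv c @^-1` U.

Let dom_open : open dom.
Proof.
apply: openI; first exact: (sheet_open sh).
by move/continuousP: pc; apply; exact: chart_dom_open.
Qed.

Let cod_open : open cod.
Proof. by apply: open_preimage_chart_inv; exact: (sheet_base_open sh). Qed.

Let homo e : dom e -> cod (c (p e)).
Proof.
move=> [We ce]; split; first exact: chart_homo.
by rewrite /= chartK //; exact: (sheet_proj sh We).
Qed.

Let inv_homo v : cod v -> dom (s (chart_inv c v)).
Proof.
move=> [cv Uv]; split; first exact: (sheet_section sh).
by rewrite /= (sheet_sectionK sh Uv); exact: chart_inv_homo.
Qed.

Let funK e : dom e -> s (chart_inv c (c (p e))) = e.
Proof. by move=> [We ce]; rewrite chartK // (sheet_projK sh We). Qed.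

Let invK v : cod v -> c (p (s (chart_inv c v))) = v.
Proof. by move=> [cv Uv]; rewrite (sheet_sectionK sh Uv) chart_invK. Qed.

Let fun_continuous : {within dom, continuous (fun e => c (p e))}.
Proof.
rewrite continuous_open_subspace // => e; rewrite inE => -[We ce].
by apply: (continuous_at_comp (g := c) (@pc e)); exact: chart_continuous_at.
Qed.

Let inv_continuous : {within cod, continuous (fun v => s (chart_inv c v))}.
Proof.
rewrite continuous_open_subspace // => v; rewrite inE => -[cv Uv].
apply: (continuous_at_comp (g := s) (chart_inv_continuous_at cv)).
exact: (sheet_continuous sh Uv).
Qed.

Definition lift_chart : chart R E n :=
  Chart dom_open cod_open homo inv_homo funK invK fun_continuous inv_continuous.

End lift_chart.

(** In charts lifted through local sections of [p], the multiplication and the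
    inverse of [E] have the same coordinate expressions as those of [G], on
    smaller open domains. *)
Lemma covering_lie_structure (R : realType) (E : topGroupType)
    (G : lieGroupType R) (p : E -> G) :
  covering_map p -> {morph p : g h / (g * h)%g} ->
  exists (n : nat) (A : set (chart R E n)), smooth_atlas A /\ smooth_group_law A.
Proof.
move=> covp pM; have [n [A [[Acov Asm] [Amul Ainv]]]] := @lie_smooth R G.
have p1 : p 1%g = 1%g by apply: (mulgI (p 1%g)); rewrite -pM !mulg1.
have pV g : p g^-1%g = (p g)^-1%g by apply: (mulgI (p g)); rewrite -pM !mulgV.
have pc := covering_continuous covp.
exists n, [set c' | exists c W U s V (sh : sheet p W U s V),
  A c /\ c' = lift_chart pc sh c].
split; split.
- move=> e; have [W [U [s [V [sh We]]]]] := covering_sheet covp e.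
  have [c Ac ce] := Acov (p e).
  by exists (lift_chart pc sh c) => //; exists c, W, U, s, V, sh.
- move=> _ _ [c [W [U [s [V [sh [Ac ->]]]]]]] [d [W' [U' [s' [V' [sh' [Ad ->]]]]]]].
  apply: smooth_local (Asm c d Ac Ad).
  + exact/open_preimage_chart_inv/chart_dom_open.
  + by move=> v [[cv Uv] /= [_]]; rewrite (sheet_sectionK sh Uv).
  + by move=> v [[cv Uv] _] /=; rewrite (sheet_sectionK sh Uv).
- move=> _ _ _ [c [W1 [U1 [s1 [V1 [sh1 [Ac ->]]]]]]]
    [d [W2 [U2 [s2 [V2 [sh2 [Ad ->]]]]]]] [e [W3 [U3 [s3 [V3 [sh3 [Ae ->]]]]]]].
  apply: smooth_local (Amul c d e Ac Ad Ae).
  + rewrite openE => -[v w] /= [cv dw emul].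
    set cE := lift_chart pc sh1 c in cv emul *.
    set dE := lift_chart pc sh2 d in dw emul *.
    set eE := lift_chart pc sh3 e in emul *.
    have ncE : nbhs v (chart_cod cE).
      by apply: open_nbhs_nbhs; split => //; exact: chart_cod_open.
    have ndE : nbhs w (chart_cod dE).
      by apply: open_nbhs_nbhs; split => //; exact: chart_cod_open.
    have neE : nbhs (chart_inv cE v * chart_inv dE w)%g (chart_dom eE).
      by apply: open_nbhs_nbhs; split => //; exact: chart_dom_open.
    have mulc : {for (v, w), continuous (fun z : 'rV[R]_n * 'rV[R]_n =>
        chart_inv cE z.1 * chart_inv dE z.2)%g}.
      apply: continuous_at_mulg.
        by apply: continuous_at_comp; [exact: cvg_fst|exact: chart_inv_continuous_at].
      by apply: continuous_at_comp; [exact: cvg_snd|exact: chart_inv_continuous_at].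
    have n1 : nbhs (v, w) [set z : 'rV[R]_n * 'rV[R]_n |
        chart_cod cE z.1 /\ chart_cod dE z.2].
      by exists (chart_cod cE, chart_cod dE).
    have n2 : nbhs (v, w) [set z : 'rV[R]_n * 'rV[R]_n |
        chart_dom eE (chart_inv cE z.1 * chart_inv dE z.2)%g] by exact: mulc neE.
    by apply: filterS2 n1 n2 => z [].
  + move=> [v w] /= [[cv Uv] [dw Uw] [_]] /=.
    by rewrite pM (sheet_sectionK sh1 Uv) (sheet_sectionK sh2 Uw).
  + move=> [v w] /= [[cv Uv] [dw Uw] _] /=.
    by rewrite pM (sheet_sectionK sh1 Uv) (sheet_sectionK sh2 Uw).
- move=> _ _ [c [W [U [s [V [sh [Ac ->]]]]]]] [d [W' [U' [s' [V' [sh' [Ad ->]]]]]]].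
  apply: smooth_local (Ainv c d Ac Ad).
  + apply: (@open_preimage_chart_inv _ _ _ _
      ((fun e : E => e^-1)%g @^-1` chart_dom (lift_chart pc sh' d))).
    by move/continuousP: (@invg_continuous E); apply; exact: chart_dom_open.
  + by move=> v [[cv Uv] /= [_]]; rewrite /= pV (sheet_sectionK sh Uv).
  + by move=> v [[cv Uv] _] /=; rewrite pV (sheet_sectionK sh Uv).
Qed.

Section lift_lie.
Variables (R : realType) (G : lieGroupType R) (X : topologicalType).
Variables (act : G -> X -> X) (x : orbit_space act -> X).
Hypotheses (polX : polar_space act) (secx : polar_section x).
Variable P : polcov x.

HB.instance Definition _ := isLieGroup.Build R (lift_space polX secx P)
  (@lift_hausdorff _ _ _ _ _ polX secx P)
  (covering_lie_structure (@lift_proj_covering _ _ _ _ _ polX secx P)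
    (@lift_projM _ _ _ _ _ polX secx P)).

End lift_lie.

(** * The functor to discrete extensions *)

Section br.
Variables (R : realType) (G : lieGroupType R) (X : topologicalType).
Variables (act : G -> X -> X) (x : orbit_space act -> X).
Hypotheses (polX : polar_space act) (secx : polar_section x).
Local Notation Q := (orbit_space act).
Local Notation H := (isotropy x).

Lemma isotropyP (h : H) : act (set_val h).1 (x (set_val h).2) = x (set_val h).2.
Proof. exact: (set_valP h). Qed.

Lemma isotropy_ex z : act z.1 (x z.2) = x z.2 -> exists h : H, set_val h = z.
Proof.
move=> zH; have zH' : z \in H by rewrite inE.
by exists (SigSub zH').
Qed.

Section isotropy.
Variable P : polcov x.
Local Notation p := (@pc_proj _ _ _ _ _ P).
Variables (K : topGroupType) (pr : K -> G) (a : K -> P -> P) (u : H -> K * Q).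
Hypotheses (Ka : lift_group pr a) (prM : {morph pr : g h / (g * h)%g}).
Hypothesis aM : forall g h y, a (g * h)%g y = a g (a h y).
Hypothesis u_fix : forall h, a (u h).1 (pc_lift P (u h).2) = pc_lift P (u h).2.
Hypothesis u_unique : forall z h, a z.1 (pc_lift P z.2) = pc_lift P z.2 ->
  set_val h = (pr z.1, z.2) -> u h = z.

Lemma lift_group_a1 y : a 1%g y = y.
Proof.
have [[_ [f _ [aK _]]] _] := lift_groupP Ka 1%g.
by apply: (can_inj aK); rewrite -aM mulg1.
Qed.

(** The fibres of the orbit map of the lifted section are the cosets of the
    isotropy: if [y] and [z] have the same image, then [y.1^-1 * z.1] fixes the
    lift over [y.2]. *)
Lemma coset_relP y z :
  a y.1 (pc_lift P y.2) = a z.1 (pc_lift P z.2) <-> coset_rel u y z.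
Proof.
split => [yz|[h [uy ->]]]; last by rewrite /= aM -uy u_fix.
have [_ _ pa _ _] := Ka.
have phiyz : phi x (pr y.1, y.2) = phi x (pr z.1, z.2).
  by rewrite /phi /= -!(pc_liftP P) -!pa yz.
have [/= yz2 fix_yz] := phi_eq polX secx phiyz.
pose w := (y.1^-1 * z.1, y.2)%g.
have prw : pr w.1 = ((pr y.1)^-1 * pr z.1)%g.
  by apply: (mulgI (pr y.1)); rewrite -prM mulVKg mulVKg.
have wfix : a w.1 (pc_lift P w.2) = pc_lift P w.2.
  by rewrite /= aM yz2 -yz -yz2 -aM mulVg lift_group_a1.
have [|h hw] := isotropy_ex (z := (pr w.1, w.2)); first by rewrite prw.
have uw : u h = w by apply: u_unique.
exists h; rewrite uw /= mulVKg; split => //.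
by rewrite yz2 -surjective_pairing.
Qed.

End isotropy.

Section object.
Variable P : polcov x.
Local Notation p := (@pc_proj _ _ _ _ _ P).
Local Notation K := (lift_space polX secx P).
Let Ka := lift_space_lift_group polX secx P.

Lemma br_u_ex (h : H) : exists k : K, lift_proj k = (set_val h).1 /\
  lift_fun k (pc_lift P (set_val h).2) = pc_lift P (set_val h).2.
Proof. by apply: (lift_group_exists polX Ka); rewrite pc_liftP isotropyP. Qed.

Definition br_u (h : H) : K * Q := (projT1 (cid (br_u_ex h)), (set_val h).2).

Lemma br_u_proj h : lift_proj (br_u h).1 = (set_val h).1.
Proof. by have [] := projT2 (cid (br_u_ex h)). Qed.

Lemma br_u_fix h :
  lift_fun (br_u h).1 (pc_lift P (br_u h).2) = pc_lift P (br_u h).2.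
Proof. by have [] := projT2 (cid (br_u_ex h)). Qed.

Lemma br_u_unique (z : K * Q) h : lift_fun z.1 (pc_lift P z.2) = pc_lift P z.2 ->
  set_val h = (lift_proj z.1, z.2) -> br_u h = z.
Proof.
move=> zfix hz; have q_z : (br_u h).2 = z.2 by rewrite /= hz.
rewrite (surjective_pairing (br_u h)) (surjective_pairing z) q_z; congr pair.
apply: (lift_group_eq Ka (y := pc_lift P z.2)); first by rewrite br_u_proj hz.
by rewrite zfix -q_z br_u_fix.
Qed.

Lemma br_u_continuous : continuous br_u.
Proof.
have valc : continuous (set_val : H -> G * Q) by exact: initial_continuous.
have val1c : continuous (fun h : H => (set_val h).1).
  by move=> h; apply: (continuous_at_comp (@valc h)); exact: cvg_fst.
have val2c : continuous (fun h : H => (set_val h).2).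
  by move=> h; apply: (continuous_at_comp (@valc h)); exact: cvg_snd.
have liftc : continuous (fun h : H => pc_lift P (set_val h).2).
  by move=> h; apply: (continuous_at_comp (@val2c h)); exact: pc_lift_continuous.
move=> h; apply: (@continuous_at_pair _ _ _ h (fun h => (br_u h).1)
  (fun h => (set_val h).2)); last exact: val2c.
apply: (lift_group_continuous Ka (f := fun h => (br_u h).1)
  (y := fun h => pc_lift P (set_val h).2)).
- rewrite (_ : _ \o _ = fun h : H => (set_val h).1); first exact: val1c.
  by apply: funext => k /=; rewrite br_u_proj.
- exact: liftc.
- rewrite (_ : (fun b => _) = fun h : H => pc_lift P (set_val h).2).
    exact: liftc.
  by apply: funext => k; exact: br_u_fix.
Qed.

Lemma lift_proj_extension : discrete_extension (@lift_proj _ _ _ _ _ polX secx P).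
Proof.
apply: covering_discrete_extension.
- exact: lift_proj_covering.
- exact: lift_projM.
- move=> g; pose y := base_lift polX P.
  have [z pz] := pc_surjective polX P (act g (p y)).
  by have [k [kg _]] := lift_group_exists polX Ka pz; exists k.
Qed.

Lemma br_u_qgroup : qgroup_morphism br_u.
Proof.
split; [exact: br_u_continuous|by []|move=> h k l hk lE].
apply: (lift_group_eq Ka (y := pc_lift P (set_val h).2)).
  by rewrite lift_projM !br_u_proj lE.
have ufix h' q : (set_val h').2 = q ->
    lift_fun (br_u h').1 (pc_lift P q) = pc_lift P q.
  by move=> <-; exact: br_u_fix.
by rewrite lift_funM !ufix // lE.
Qed.

(** The quotient is the image of [P], which is connected. *)
Lemma br_u_ubiquitous : ubiquitous br_u.
Proof.
pose k (z : K * Q) := lift_fun z.1 (pc_lift P z.2).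
have kq : quotient_map k by exact: (lift_group_quotient polX secx Ka).
have [|s s' ks|g gc gk] := @quotient_map_factor _ _ _ _
    (quot_pi (coset_rel br_u)) kq.
- exact: pi_continuous.
- apply/eqmodP/asboolP/rst_step.
  by apply/(coset_relP Ka) => //; [exact: lift_projM|exact: br_u_fix|
    exact: br_u_unique].
rewrite /ubiquitous (_ : setT = g @` setT).
  apply: connected_continuous_connected; first exact: pc_connected.
  exact: continuous_subspaceT.
rewrite eqEsubset; split => // t _; exists (k (repr t)) => //.
by rewrite gk; exact: reprK.
Qed.

Definition br_ext : ext x :=
  @Ext _ _ _ _ x K (@lift_proj _ _ _ _ _ polX secx P) br_u lift_proj_extension
    br_u_qgroup br_u_ubiquitous
    (fun h => etrans (congr1 (pair^~ _) (br_u_proj h))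
      (esym (surjective_pairing (set_val h)))).

End object.

Section morphism.
Variables (P1 P2 : polcov x) (f : polcov_hom P1 P2).
Local Notation K1 := (lift_space polX secx P1).
Local Notation K2 := (lift_space polX secx P2).
Let K2a := lift_space_lift_group polX secx P2.

(** The value at the base point determines [k]; unique lifting then gives the
    intertwining relation everywhere. *)
Lemma br_map_ex (g : K1) : exists k : K2, lift_proj k = lift_proj g /\
  forall y, f (lift_fun g y) = lift_fun k (f y).
Proof.
have [|k [kg kb]] := @lift_group_exists _ _ _ _ _ polX _ _ _ _ K2a (lift_proj g)
    (f (base_lift polX P1)) (f (lift_fun g (base_lift polX P1))).
  by rewrite !pch_proj lift_spaceE.
exists k; split => //; apply: (covering_unique_lift (pc_covering P2)
  (f := f \o lift_fun g) (g := lift_fun k \o f) (pc_connected (P := P1))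
  _ _ _ (esym kb)).
- move=> y; apply: (continuous_at_comp (g := f)
    (@lift_fun_continuous _ _ _ _ _ _ _ _ g y)).
  exact: pch_continuous.
- move=> y; apply: (continuous_at_comp (g := lift_fun k)
    (@pch_continuous _ _ _ _ _ _ _ f y)).
  exact: lift_fun_continuous.
- by move=> y /=; rewrite lift_spaceE !pch_proj lift_spaceE kg.
Qed.

Definition br_map (g : br_ext P1) : br_ext P2 := projT1 (cid (br_map_ex g)).

Lemma br_map_proj g : lift_proj (br_map g) = lift_proj g.
Proof. by have [] := projT2 (cid (br_map_ex g)). Qed.

Lemma br_mapE g y : f (lift_fun g y) = lift_fun (br_map g) (f y).
Proof. by have [_ ->] := projT2 (cid (br_map_ex g)). Qed.

Lemma br_map_unique (g : K1) (k : K2) y : lift_proj k = lift_proj g ->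
  f (lift_fun g y) = lift_fun k (f y) -> br_map g = k.
Proof.
move=> kg ky; apply: (lift_group_eq K2a (y := f y)); rewrite ?br_map_proj //.
by rewrite -ky -br_mapE.
Qed.

Lemma br_map_morphism : lie_morphism br_map.
Proof.
split.
  move=> g; apply: (lift_group_continuous K2a (f := br_map)
    (y := fun=> f (base_lift polX P1))).
  - rewrite (_ : _ \o _ = @lift_proj _ _ _ _ _ polX secx P1).
      exact: lift_proj_continuous.
    by apply: funext => h /=; rewrite br_map_proj.
  - exact: continuous_at_cst.
  - rewrite (_ : (fun b => _) = f \o (fun g : K1 => lift_fun g (base_lift polX P1))).
      apply: continuous_at_comp; first exact: lift_base_continuous.
      exact: pch_continuous.
    by apply: funext => h; rewrite -br_mapE.
move=> g h; apply: (br_map_unique (y := base_lift polX P1)).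
  by rewrite !lift_projM !br_map_proj.
by rewrite !lift_funM -!br_mapE.
Qed.

Lemma br_map_u (h : H) :
  (br_map (ext_u (br_ext P1) h).1, (ext_u (br_ext P1) h).2) = ext_u (br_ext P2) h.
Proof.
rewrite [RHS]surjective_pairing; congr pair.
apply: (br_map_unique (y := pc_lift P1 (set_val h).2)).
  by rewrite !br_u_proj.
by rewrite (@br_u_fix P1 h) pch_lift (@br_u_fix P2 h).
Qed.

Definition br_hom : ext_hom (br_ext P1) (br_ext P2) :=
  ExtHom br_map_morphism br_map_proj br_map_u.

End morphism.

Lemma br_hom1 (P : polcov x) : br_hom (polcov_id P) = ext_id (br_ext P).
Proof.
apply: ext_hom_eq; apply: funext => g /=.
exact: (br_map_unique (y := base_lift polX P)).
Qed.

Lemma br_homM (P1 P2 P3 : polcov x) (f : polcov_hom P2 P3) (g : polcov_hom P1 P2) :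
  br_hom (polcov_comp f g) = ext_comp (br_hom f) (br_hom g).
Proof.
apply: ext_hom_eq; apply: funext => h /=.
apply: (br_map_unique (y := base_lift polX P1)); first by rewrite !br_map_proj.
by rewrite /= !br_mapE.
Qed.

Definition br_functor : functor (Pol_Cov x) (E_cat x) :=
  @Functor (Pol_Cov x) (E_cat x) br_ext br_hom br_hom1 br_homM.

Definition br_act (P : polcov x) : (br_functor P : ext x) -> P -> P :=
  @lift_fun _ _ _ _ _ polX secx P.

Lemma br_functorP : Br_functor br_act.
Proof.
split => [P|P1 P2 f g y]; last exact: br_mapE.
have [aI aT pa Kcov ac] := lift_space_lift_group polX secx P.
split; [split; [split => //|split => //]|split].
- exact: br_u_fix.
- exact: br_u_unique.
Qed.

End br.

(** * Slices of a regular polar space *)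

Section slice.
Variables (R : realType) (G : lieGroupType R) (X : topologicalType).
Variables (act : G -> X -> X) (x : orbit_space act -> X).
Hypotheses (polX : polar_space act) (secx : polar_section x).
Local Notation Q := (orbit_space act).
Local Notation H := (isotropy x).

Lemma isotropy1 q : H (1%g, q).
Proof. by rewrite /isotropy /= (act1 polX). Qed.

Lemma isotropyM g h q : H (g, q) -> H (h, q) -> H ((g * h)%g, q).
Proof. by rewrite /isotropy /= (actM polX) => gq ->. Qed.

Lemma isotropyV g q : H (g, q) -> H (g^-1%g, q).
Proof. by rewrite /isotropy /= => gq; rewrite -{1}gq (actK polX). Qed.

Variable E : ext x.
Local Notation p := (@ext_proj _ _ _ _ _ E).
Let pM : {morph p : g h / (g * h)%g} := extM (ext_discrete E).
Let pV g : p g^-1%g = (p g)^-1%g := extV (ext_discrete E) g.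
Let p1 : p 1%g = 1%g := ext1 (ext_discrete E).
Let covp : covering_map p := discrete_extension_covering (ext_discrete E).
Let pc : continuous p := covering_continuous covp.

(** Made total so that [ext_u] can be evaluated along paths of [G * Q] whose
    points lie in the isotropy only by a proof. *)
Definition ext_sec (z : G * Q) : E :=
  if pselect (H z) is left Hz then (ext_u E (SigSub (mem_set Hz))).1 else 1%g.

Lemma ext_u2 (h : H) : (ext_u E h).2 = (set_val h).2.
Proof. by rewrite -(ext_lift E h). Qed.

Lemma ext_sec_val (h : H) : ext_sec (set_val h) = (ext_u E h).1.
Proof.
rewrite /ext_sec; case: pselect => [Hh|]; last by case; exact: set_valP.
by congr (ext_u E _).1; exact: val_inj.
Qed.

Lemma ext_uE (h : H) : ext_u E h = (ext_sec (set_val h), (set_val h).2).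
Proof. by rewrite ext_sec_val -ext_u2 -surjective_pairing. Qed.

Lemma ext_secK z : H z -> p (ext_sec z) = z.1.
Proof. by move=> /isotropy_ex[h <-]; rewrite ext_sec_val -[in RHS](ext_lift E h). Qed.

Lemma ext_secM g h q : H (g, q) -> H (h, q) ->
  ext_sec ((g * h)%g, q) = (ext_sec (g, q) * ext_sec (h, q))%g.
Proof.
move=> Hg Hh; have := isotropyM Hg Hh.
move: Hg Hh => /isotropy_ex[h1 h1E] /isotropy_ex[h2 h2E] /isotropy_ex[h3 h3E].
have [_ _ uM] := ext_qgroup E.
by rewrite -h1E -h2E -h3E !ext_sec_val; apply: uM; rewrite h1E ?h2E ?h3E.
Qed.

Lemma ext_sec1 q : ext_sec (1%g, q) = 1%g.
Proof.
apply: (mulgI (ext_sec (1%g, q))); have H1 := isotropy1 q.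
by rewrite -(ext_secM H1 H1) !mulg1.
Qed.

Lemma ext_secV g q : H (g, q) -> ext_sec (g^-1%g, q) = (ext_sec (g, q))^-1%g.
Proof.
move=> Hg; apply: (mulgI (ext_sec (g, q))).
by rewrite -(ext_secM Hg (isotropyV Hg)) !mulgV ext_sec1.
Qed.

Lemma ext_sec_continuous (A : topologicalType) (g : A -> G * Q) (a : A) :
  (\forall b \near a, H (g b)) -> {for a, continuous g} ->
  {for a, continuous (fun b => ext_sec (g b))}.
Proof.
move=> Hg gc.
have : {within H, continuous ext_sec}.
  apply/subspace_sigL_continuousP.
  rewrite (_ : sigL H ext_sec = fun h => (ext_u E h).1).
    have [uc _ _] := ext_qgroup E.
    by move=> h; apply: (continuous_at_comp (g := fst) (@uc h)); exact: cvg_fst.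
  by apply: funext => h; exact: ext_sec_val.
move=> /subspace_continuousP /(_ _ (nbhs_singleton Hg)) secc N nN.
have := gc _ (secc N nN).
by apply: filterS2 Hg => b Hb; exact.
Qed.

Lemma coset_relE y z : coset_rel (ext_u E) y z <->
  exists2 g, H (g, y.2) & z = (y.1 * ext_sec (g, y.2), y.2)%g.
Proof.
split => [[h []]|[g /isotropy_ex[h hE] ->]].
  rewrite ext_uE /= => hy ->; exists (set_val h).1.
    by rewrite -hy -surjective_pairing; exact: set_valP.
  by rewrite -hy -surjective_pairing.
by exists h; rewrite ext_uE hE.
Qed.

Definition ext_phi (z : E * Q) : X := phi x (p z.1, z.2).

Lemma ext_phi_coset y z : coset_rel (ext_u E) y z -> ext_phi y = ext_phi z.
Proof.
move=> /coset_relE[g Hg ->]; rewrite /ext_phi /phi /= pM (ext_secK Hg) /=.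
by rewrite (actM polX) Hg.
Qed.

Lemma ext_phi_eq y z : ext_phi y = ext_phi z -> exists k g,
  [/\ p k = 1%g, H (g, y.2) & z = (k * (y.1 * ext_sec (g, y.2)), y.2)%g].
Proof.
move=> /(phi_eq polX secx)[/= yz2 Hg'].
have Hg : H ((p y.1)^-1 * p z.1, y.2)%g by [].
exists (z.1 * (y.1 * ext_sec (((p y.1)^-1 * p z.1)%g, y.2))^-1)%g.
exists ((p y.1)^-1 * p z.1)%g; split => //.
  by rewrite pM pV pM (ext_secK Hg) /= mulVKg mulgV.
by rewrite mulgVK yz2 -surjective_pairing.
Qed.

Section regular.
Local Open Scope ring_scope.
Variables (q : Q) (U : set X) (h : R -> G * Q -> G * Q).
Hypothesis openU : open_nbhs (x q) U.
Local Notation D := (phi x @^-1` U).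
Hypothesis h_retract :
  deformation_retraction D (H `&` [set z | z.2 = q]) h.
Hypothesis h_isotropy : forall t z, `[0, 1]%classic t -> (D `&` H) z ->
  (D `&` H) (h t z).
Hypothesis h_base : forall y z, D y -> D z -> y.2 = z.2 ->
  forall t, `[0, 1]%classic t -> (h t y).2 = (h t z).2.

Let clamp (t : R) : R := Num.max (Num.min t 1) 0.

Let clampI t : `[0, 1]%classic (clamp t).
Proof.
by rewrite /= in_itv /= /clamp le_max lexx orbT ge_max ge_min lexx orbT ler01.
Qed.

Let clamp_id t : `[0, 1]%classic t -> clamp t = t.
Proof.
by rewrite /= in_itv /= => /andP[t0 t1]; rewrite /clamp min_l // max_l.
Qed.

Let clamp0 : clamp 0 = 0.
Proof. by apply: clamp_id; rewrite /= in_itv /= lexx ler01. Qed.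

Let clamp1 : clamp 1 = 1.
Proof. by apply: clamp_id; rewrite /= in_itv /= lexx ler01. Qed.

Let clamp_continuous : continuous clamp.
Proof.
move=> t; apply: (@continuous_at_comp _ _ _ t (Num.min^~ 1) (Num.max^~ 0)).
  by apply: continuous_min; [exact: cvg_id|exact: cvg_cst].
by apply: continuous_max; [exact: cvg_id|exact: cvg_cst].
Qed.

Let Rconn : connected [set: R].
Proof. exact/connected_intervalP. Qed.

Let Rloc : locally_connected R.
Proof.
move=> t N /nbhs_ballP[e /= e0 eN]; exists (ball t e); split => //.
  by split; [exact: ball_open|exact: ballxx].
apply/connected_intervalP => a b; rewrite /ball /= !ltr_distl => ta tb c /andP[ac cb].
by rewrite ltr_distl; move: ta tb => /andP[? ?] /andP[? ?]; apply/andP; split; lra.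
Qed.

(** Extending the times to [R] makes paths total functions. *)
Let eta t y := h (clamp t) y.

Let D_open : open D.
Proof.
have [phic _ _] := phi_quotient secx.
by move/continuousP: phic; apply; case: openU.
Qed.

Let etaD t y : D y -> D (eta t y).
Proof. by have [_ [_ hD _ _ _]] := h_retract; apply: hD; exact: clampI. Qed.

Let etaH t y : D y -> H y -> H (eta t y).
Proof. by move=> Dy Hy; have [] := h_isotropy (clampI t) (conj Dy Hy). Qed.

Let eta0 y : D y -> eta 0 y = y.
Proof. by have [_ [_ _ h0 _ _]] := h_retract; rewrite /eta clamp0; exact: h0. Qed.

Let eta1 y : D y -> H (eta 1 y) /\ (eta 1 y).2 = q.
Proof. by have [_ [_ _ _ h1 _]] := h_retract; rewrite /eta clamp1; exact: h1. Qed.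

Let eta_base t y z : D y -> D z -> y.2 = z.2 -> (eta t y).2 = (eta t z).2.
Proof. by move=> Dy Dz yz; exact: h_base. Qed.

Let eta_continuous t y : D y ->
  {for (t, y), continuous (fun z : R * (G * Q) => eta z.1 z.2)}.
Proof.
move=> Dy; have [_ [/subspace_continuousP hc _ _ _ _]] := h_retract.
move=> N nN; have nN' := hc (clamp t, y) (conj (clampI t) Dy) N nN.
have cc : {for (t, y), continuous (fun z : R * (G * Q) => (clamp z.1, z.2))}.
  apply: continuous_at_pair; last exact: cvg_snd.
  by apply: (@continuous_at_comp _ _ _ (t, y) fst clamp);
    [exact: cvg_fst|exact: clamp_continuous].
have nD : nbhs (t, y) [set z : R * (G * Q) | D z.2].
  by apply: (@cvg_snd _ _ (nbhs t) (nbhs y)); exact: open_nbhs_nbhs.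
have nN2 : nbhs (t, y) [set z : R * (G * Q) |
    (`[0, 1]%classic `*` D) (clamp z.1, z.2) -> N (eta z.1 z.2)] by exact: cc nN'.
apply: filterS2 nN2 nD => z /= zN Dz.
by apply: zN; split => //; exact: clampI.
Qed.

Let eta_continuous_t y : D y -> continuous (eta^~ y).
Proof.
move=> Dy t; apply: (@continuous_at_comp _ _ _ t (fun t => (t, y))
  (fun z : R * (G * Q) => eta z.1 z.2)); last exact: eta_continuous.
by apply: continuous_at_pair; [exact: cvg_id|exact: cvg_cst].
Qed.

Let P (y : E * Q) : G * Q := (p y.1, y.2).

Let P_continuous : continuous P.
Proof.
move=> y; apply: (@continuous_at_pair _ _ _ y (p \o fst) snd); last exact: cvg_snd.
by apply: (@continuous_at_comp _ _ _ y fst p); [exact: cvg_fst|exact: pc].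
Qed.

Let lam_ex (y : E * Q) : exists l : R -> E, D (P y) ->
  [/\ continuous l, l 0 = y.1 & forall t, p (l t) = (eta t (P y)).1].
Proof.
have [Dy|nDy] := pselect (D (P y)); last by exists (fun=> 1%g).
have gc : continuous (fun t => (eta t (P y)).1).
  move=> t; apply: (@continuous_at_comp _ _ _ t (eta^~ (P y)) fst).
    exact: eta_continuous_t.
  exact: cvg_fst.
have [|l [lc l0 pl]] := ext_path_lift (ext_discrete E) gc (e := y.1).
  by rewrite eta0.
exists l => _; split => // t; rewrite pl /eta; congr (h _ _).1.
by apply: clamp_id; exact: clampI.
Qed.

(** The first component of the retraction of [D], lifted to [E * Q]. *)
Let lam (y : E * Q) : R -> E := projT1 (cid (lam_ex y)).

Let lamP y : D (P y) -> [/\ continuous (lam y), lam y 0 = y.1 &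
  forall t, p (lam y t) = (eta t (P y)).1].
Proof. exact: projT2 (cid (lam_ex y)). Qed.

Let lam_continuous_t y : D (P y) -> continuous (lam y).
Proof. by move=> /lamP[]. Qed.

Let lam0 y : D (P y) -> lam y 0 = y.1.
Proof. by move=> /lamP[]. Qed.

Let p_lam y t : D (P y) -> p (lam y t) = (eta t (P y)).1.
Proof. by move=> /lamP[_ _ pl]; exact: pl. Qed.

Let eta1_lam y : D (P y) -> eta 1 (P y) = (p (lam y 1), q).
Proof.
by move=> Dy; rewrite p_lam // -(eta1 Dy).2 -surjective_pairing.
Qed.

Let H_lam y : D (P y) -> H (p (lam y 1), q).
Proof. by move=> Dy; rewrite -eta1_lam //; case: (eta1 Dy). Qed.

Let near_D y : D (P y) -> \forall z \near y, D (P z).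
Proof. by move=> Dy; apply: P_continuous; exact: open_nbhs_nbhs. Qed.

Let lam_continuous y t : D (P y) ->
  {for (y, t), continuous (fun z : (E * Q) * R => lam z.1 z.2)}.
Proof.
move=> Dy; move: t.
apply: (covering_lift_continuous covp (F := lam)
  (f := fun z : (E * Q) * R => (eta z.2 (P z.1)).1) (y0 := 0)) => //.
- move=> t; apply: (@continuous_at_comp _ _ _ (y, t)
    (fun z : (E * Q) * R => eta z.2 (P z.1)) fst); last exact: cvg_fst.
  apply: (@continuous_at_comp _ _ _ (y, t) (fun z : (E * Q) * R => (z.2, P z.1))
    (fun z : R * (G * Q) => eta z.1 z.2)); last exact: eta_continuous.
  apply: continuous_at_pair; first exact: cvg_snd.
  by apply: (@continuous_at_comp _ _ _ (y, t) fst P);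
    [exact: cvg_fst|exact: P_continuous].
- apply: filterS (near_D Dy) => z Dz; split; first exact: lam_continuous_t.
  by move=> t; exact: p_lam.
- apply: (continuous_near_eq (f := fst)); last exact: cvg_fst.
  by apply: filterS (near_D Dy) => z Dz; rewrite lam0.
Qed.

Let lam_unique y (l : R -> E) : D (P y) -> continuous l -> l 0 = y.1 ->
  (forall t, p (l t) = (eta t (P y)).1) -> forall t, lam y t = l t.
Proof.
move=> Dy lc l0 pl; apply: (covering_unique_lift covp Rconn
  (lam_continuous_t Dy) lc (a := 0)); last by rewrite lam0.
by move=> t; rewrite pl p_lam.
Qed.

Let P_sec z : H z -> P (ext_sec z, z.2) = z.
Proof. by move=> Hz; rewrite /P /= ext_secK // -surjective_pairing. Qed.

Let lam_sec z t : D z -> H z -> lam (ext_sec z, z.2) t = ext_sec (eta t z).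
Proof.
move=> Dz Hz; move: t; apply: lam_unique.
- by rewrite P_sec.
- move=> t; apply: (@ext_sec_continuous _ (eta^~ z)); last exact: eta_continuous_t.
  by apply: near_all => s; exact: etaH.
- by rewrite /= eta0.
- by move=> t; rewrite P_sec // ext_secK //; exact: etaH.
Qed.

Let lam_mul k y t : p k = 1%g -> D (P y) -> lam (k * y.1, y.2)%g t = (k * lam y t)%g.
Proof.
move=> pk Dy; have PE : P (k * y.1, y.2)%g = P y by rewrite /P /= pM pk mul1g.
move: t; apply: lam_unique.
- by rewrite PE.
- move=> t; apply: (@continuous_at_mulg _ _ (fun=> k) (lam y)).
    exact: cvg_cst.
  exact: lam_continuous_t.
- by rewrite lam0.
- by move=> t; rewrite PE pM pk mul1g p_lam.
Qed.

(** The sheet at the coset of [(1, q)]: the lifted retraction must end in the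
    image of [ext_u]. The condition on [x y.2] puts the isotropy over [y.2] into
    [D], so that the retraction moves it along with [y]. *)
Let W : set (E * Q) :=
  [set y | [/\ D (P y), U (x y.2) & lam y 1 = ext_sec (p (lam y 1), q)]].

Let W_open : open W.
Proof.
rewrite openE => y [Dy Uy ly].
have lc : {for y, continuous (fun z => lam z 1)}.
  apply: (@continuous_at_comp _ _ _ y (fun z => (z, 1 : R))
    (fun z : (E * Q) * R => lam z.1 z.2)); last exact: lam_continuous.
  by apply: continuous_at_pair; [exact: cvg_id|exact: cvg_cst].
have sc : {for y, continuous (fun z => ext_sec (p (lam z 1), q))}.
  apply: (@ext_sec_continuous _ (fun z => (p (lam z 1), q))).
    by apply: filterS (near_D Dy) => z; exact: H_lam.
  apply: continuous_at_pair; last exact: cvg_cst.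
  by apply: (@continuous_at_comp _ _ _ y (fun z => lam z 1) p) => //; exact: pc.
have nl : \forall z \near y, lam z 1 = ext_sec (p (lam z 1), q).
  apply: (covering_lift_near covp lc sc ly).
  by apply: filterS (near_D Dy) => z Dz; rewrite ext_secK //; exact: H_lam.
have nU : \forall z \near y, U (x z.2).
  have xc : {for y, continuous (fun z : E * Q => x z.2)}.
    apply: (@continuous_at_comp _ _ _ y snd x); first exact: cvg_snd.
    exact: (section_continuous secx).
  by apply: xc; apply: open_nbhs_nbhs; split => //; case: openU.
by apply: filterS3 (near_D Dy) nU nl => z ? ? ?; split.
Qed.

Let W_sec z : D z -> H z -> lam (ext_sec z, z.2) 1 =
  ext_sec (p (lam (ext_sec z, z.2) 1), q).
Proof. by move=> Dz Hz; rewrite -eta1_lam P_sec // -lam_sec. Qed.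

Let W_base : W (1%g, q).
Proof.
have H1 := isotropy1 q.
have Dq : D (1%g, q) by rewrite /= /phi /= (act1 polX); case: openU.
have := W_sec Dq H1; rewrite /= ext_sec1 => lE.
by split => //=; [rewrite /P /= p1|case: openU].
Qed.

Let W_coset y z : coset_rel (ext_u E) y z -> W y -> W z.
Proof.
move=> /coset_relE[g Hg ->] [Dy Uy ly]; set z0 := (g, y.2) in Hg *.
have Dz0 : D z0 by rewrite /= /phi Hg.
have qE s : (eta s z0).2 = (eta s (P y)).2 by apply: eta_base.
(* The lifted paths of [y] and of the isotropy element [z0] run over the same
   path of [Q], so their product is a path [Y] in [E * Q] that starts at the
   translate of [y]. The equation that defines [W] compares two continuous lifts
   along [Y], so it may be checked at the end of [Y], over [q]. *)
pose Y s := (lam y s * ext_sec (eta s z0), (eta s z0).2)%g.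
have Hz0 s : H (eta s z0) by exact: etaH.
have PY s : P (Y s) = ((eta s (P y)).1 * (eta s z0).1, (eta s z0).2)%g.
  by rewrite /P /= pM p_lam // ext_secK.
have DY s : D (P (Y s)).
  rewrite PY /= /phi /= (actM polX) Hz0 qE; exact: etaD.
have Yc : continuous Y.
  move=> s; apply: (@continuous_at_pair _ _ _ s
    (fun s => lam y s * ext_sec (eta s z0))%g (fun s => (eta s z0).2)).
    apply: continuous_at_mulg; first exact: lam_continuous_t.
    apply: (@ext_sec_continuous _ (eta^~ z0)); first exact: near_all.
    exact: eta_continuous_t.
  apply: (@continuous_at_comp _ _ _ s (eta^~ z0) snd); last exact: cvg_snd.
  exact: eta_continuous_t.
have fc : continuous (fun s => lam (Y s) 1).
  move=> s; apply: (@continuous_at_comp _ _ _ s (fun s => (Y s, 1 : R))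
    (fun z : (E * Q) * R => lam z.1 z.2)); last exact: lam_continuous.
  by apply: continuous_at_pair; [exact: Yc|exact: cvg_cst].
have gc : continuous (fun s => ext_sec (p (lam (Y s) 1), q)).
  move=> s; apply: (@ext_sec_continuous _ (fun s => (p (lam (Y s) 1), q))).
    by apply: near_all => r; exact: H_lam.
  apply: continuous_at_pair; last exact: cvg_cst.
  by apply: (@continuous_at_comp _ _ _ s (fun s => lam (Y s) 1) p);
    [exact: fc|exact: pc].
have key : forall s, lam (Y s) 1 = ext_sec (p (lam (Y s) 1), q).
  apply: (covering_unique_lift covp Rconn fc gc (a := 1 : R)).
    by move=> s; rewrite ext_secK //; exact: H_lam.
  have [H1 q1] := eta1 Dz0; have HP := H_lam Dy.
  have eta1E : eta 1 z0 = ((eta 1 z0).1, q) by rewrite -q1 -surjective_pairing.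
  rewrite eta1E in H1.
  pose w := (p (lam y 1) * (eta 1 z0).1, q)%g.
  have YE : Y 1 = (ext_sec w, w.2).
    by rewrite /Y q1 /w ext_secM // -ly -eta1E.
  have Hw : H w by exact: isotropyM.
  have Dw : D w by rewrite -(P_sec Hw) -YE.
  by rewrite YE; exact: W_sec.
have Y0 : Y 0 = (y.1 * ext_sec z0, y.2)%g by rewrite /Y eta0 // lam0.
by rewrite -Y0; split => //; rewrite Y0.
Qed.

(** Two points of [W] over one point of [X] differ, up to a coset, by an element
    [k] of the kernel; [k] also relates the ends of their lifted paths, and these
    ends are equal, as both are values of [ext_sec] at one point. *)
Let W_inj y z : W y -> W z -> ext_phi y = ext_phi z -> coset_rel (ext_u E) y z.
Proof.
move=> Wy Wz /ext_phi_eq[k [g [pk Hg zE]]].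
have yw : coset_rel (ext_u E) y (y.1 * ext_sec (g, y.2), y.2)%g.
  by apply/coset_relE; exists g.
set w := (_, _) in yw; have [Dw _ lw] := W_coset yw Wy.
have {}zE : z = (k * w.1, w.2)%g by [].
suff k1 : k = 1%g by rewrite zE k1 mul1g -surjective_pairing.
have [_ _] := Wz; rewrite zE lam_mul // pM pk mul1g -lw.
move=> /(congr1 (fun e => e * (lam w 1)^-1)%g).
by rewrite mulgK mulgV.
Qed.

Lemma retraction_slice : exists W : set (E * Q), [/\ open W, W (1%g, q),
  forall y z, coset_rel (ext_u E) y z -> W y -> W z &
  forall y z, W y -> W z -> ext_phi y = ext_phi z -> coset_rel (ext_u E) y z].
Proof. by exists W; split. Qed.

End regular.

(** This is what regularity is for: [W] is the sheet at the coset of [(1, q)] of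
    the projection from the space of cosets to [X]. *)
Lemma regular_slice (q : Q) : regular_section x ->
  exists W : set (E * Q), [/\ open W, W (1%g, q),
  forall y z, coset_rel (ext_u E) y z -> W y -> W z &
  forall y z, W y -> W z -> ext_phi y = ext_phi z -> coset_rel (ext_u E) y z].
Proof.
move=> /(_ q)[U oU [h /= [h1 h2 h3]]].
exact: (retraction_slice oU h1 h2 h3).
Qed.

End slice.

(** * The functor to polar coverings *)

Section c_space.
Variables (R : realType) (G : lieGroupType R) (X : topologicalType).
Variables (act : G -> X -> X) (x : orbit_space act -> X).
Hypotheses (polX : polar_space act) (secx : polar_section x).
Hypothesis regx : regular_section x.
Local Notation Q := (orbit_space act).
Local Notation H := (isotropy x).

Section object.
Variable E : ext x.
Local Notation p := (@ext_proj _ _ _ _ _ E).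
Local Notation crel := (coset_rel (ext_u E)).
Let pM : {morph p : g h / (g * h)%g} := extM (ext_discrete E).
Let p1 : p 1%g = 1%g := ext1 (ext_discrete E).
Let covp : covering_map p := discrete_extension_covering (ext_discrete E).

Lemma coset_rel_refl y : crel y y.
Proof.
apply/coset_relE; exists 1%g; first exact: (isotropy1 x polX).
by rewrite ext_sec1 // mulg1 -surjective_pairing.
Qed.

Lemma coset_rel_sym y z : crel y z -> crel z y.
Proof.
move=> /coset_relE[g Hg ->]; apply/coset_relE.
exists g^-1%g; first exact: (isotropyV polX).
by rewrite /= (ext_secV polX) // mulgK -surjective_pairing.
Qed.

Lemma coset_rel_trans y z w : crel y z -> crel z w -> crel y w.
Proof.
move=> /coset_relE[g Hg ->] /coset_relE[/= h Hh ->].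
apply/coset_relE; exists (g * h)%g; first exact: (isotropyM polX).
by rewrite (ext_secM polX) // mulgA.
Qed.

Lemma ext_phi_quotient : quotient_map (@ext_phi _ _ _ _ _ E).
Proof.
have [phic phiT phio] := phi_quotient secx.
split.
- move=> z; apply: (@continuous_at_comp _ _ _ z (fun z : E * Q => (p z.1, z.2))
    (phi x)); last exact: phic.
  apply: (@continuous_at_pair _ _ _ z (p \o fst) snd); last exact: cvg_snd.
  by apply: (@continuous_at_comp _ _ _ z fst p);
    [exact: cvg_fst|exact: covering_continuous].
- rewrite eqEsubset; split => // b _; have [[g q] <-] := phi_surjective secx b.
  by have [e <-] := ext_surjective (ext_discrete E) g; exists (e, q).
- move=> U oU; apply: phio.
  rewrite (_ : _ @^-1` U = (fun z : E * Q => (p z.1, z.2)) @`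
      ((@ext_phi _ _ _ _ _ E) @^-1` U)).
    by apply: open_map_times oU; exact: covering_open covp.
  rewrite eqEsubset; split => [[g q] Ugq|_ [z Uz <-] //].
  by have [e eg] := ext_surjective (ext_discrete E) g; exists (e, q);
    rewrite /= /ext_phi /= eg.
Qed.

Section quotient.
Variables (T : topologicalType) (kappa : E * Q -> T) (pr : T -> X).
Hypotheses (kq : quotient_map kappa) (keq : forall y z, kappa y = kappa z <-> crel y z).
Hypothesis prk : forall z, pr (kappa z) = ext_phi z.

Lemma coset_surjective t : exists z, kappa z = t.
Proof.
have [_ kappaT _] := kq; have : setT t by [].
by rewrite -kappaT => -[z _ <-]; exists z.
Qed.

Lemma coset_proj_continuous : continuous pr.
Proof.
have [phic _ _] := ext_phi_quotient; have [_ _ ko] := kq.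
apply/continuousP => U oU; apply: ko.
rewrite (_ : _ @^-1` _ = (@ext_phi _ _ _ _ _ E) @^-1` U).
  by move/continuousP: phic; apply.
by rewrite eqEsubset; split => z /=; rewrite prk.
Qed.

Lemma coset_act_ex (e : E) : exists2 f : T -> T, continuous f &
  forall z, f (kappa z) = kappa (e * z.1, z.2)%g.
Proof.
apply: (quotient_map_factor kq (f := fun z => kappa (e * z.1, z.2)%g)).
  move=> z; apply: (@continuous_at_comp _ _ _ z (fun z => (e * z.1, z.2)%g) kappa).
    apply: (@continuous_at_pair _ _ _ z (fun z => e * z.1)%g snd);
      last exact: cvg_snd.
    apply: (@continuous_at_mulg _ _ (fun=> e) fst); last exact: cvg_fst.
    exact: cvg_cst.
  by case: kq => cc _ _; exact: cc.
move=> y z /keq/coset_relE[g Hg ->].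
by apply/keq/coset_relE; exists g => //=; rewrite mulgA.
Qed.

Definition coset_act (e : E) : T -> T := projT1 (cid2 (coset_act_ex e)).

Lemma coset_act_continuous e : continuous (coset_act e).
Proof. by rewrite /coset_act; case: cid2. Qed.

Lemma coset_actE e z : coset_act e (kappa z) = kappa (e * z.1, z.2)%g.
Proof. by rewrite /coset_act; case: cid2. Qed.

Lemma coset_actM e f t : coset_act (e * f)%g t = coset_act e (coset_act f t).
Proof. by have [z <-] := coset_surjective t; rewrite !coset_actE /= mulgA. Qed.

Lemma coset_act1 t : coset_act 1%g t = t.
Proof.
by have [z <-] := coset_surjective t; rewrite !coset_actE mul1g -surjective_pairing.
Qed.

Lemma coset_act_homeo e : homeo (coset_act e).
Proof.
split; first exact: coset_act_continuous.
exists (coset_act e^-1%g); first exact: coset_act_continuous.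
by split => t; rewrite -coset_actM ?mulVg ?mulgV coset_act1.
Qed.

Lemma coset_proj_act e t : pr (coset_act e t) = act (p e) (pr t).
Proof.
have [z <-] := coset_surjective t.
by rewrite coset_actE !prk /ext_phi /phi /= pM (actM polX).
Qed.

Lemma coset_act_transitive t t' : pr t = pr t' ->
  exists2 k, p k = 1%g & coset_act k t = t'.
Proof.
have [y <-] := coset_surjective t; have [z <-] := coset_surjective t'.
rewrite !prk => /(ext_phi_eq polX secx)[k [g [pk Hg ->]]].
exists k => //; rewrite coset_actE; apply/keq/coset_relE.
by exists g => //=; rewrite mulgA.
Qed.

Lemma coset_act_free e e' t : p e = p e' -> coset_act e t = coset_act e' t -> e = e'.
Proof.
have [z <-] := coset_surjective t; rewrite !coset_actE => pe /keq.
move=> /coset_relE[/= g Hg [ez]].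
have := congr1 p ez; rewrite !pM (ext_secK E Hg) pe -[LHS]mulg1 => /mulgI /= g1.
by move: ez; rewrite -g1 /= (ext_sec1 polX) mulg1 => /mulIg.
Qed.

Lemma coset_proj_quotient (U : set X) : open (pr @^-1` U) -> open U.
Proof.
have [cc _ _] := kq; have [_ _ phio] := ext_phi_quotient.
move=> oU; apply: phio; rewrite (_ : _ @^-1` U = kappa @^-1` (pr @^-1` U)).
  by move/continuousP: cc; apply.
by rewrite eqEsubset; split => z /=; rewrite prk.
Qed.

(** The preimage of the image of [V] is the union of the translates of [V] by the
    kernel. *)
Lemma coset_proj_open : open_map pr.
Proof.
move=> V oV; apply: coset_proj_quotient.
rewrite (_ : _ @^-1` _ = \bigcup_(k in p @^-1` [set 1%g]) (coset_act k @` V)).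
  by apply: bigcup_open => k _; exact: (homeo_open (coset_act_homeo k)).
rewrite eqEsubset; split => [t [v Vv /coset_act_transitive[k pk kv]]|].
  by exists k => //; exists v.
by move=> _ [k /= pk [v Vv <-]]; exists v => //; rewrite coset_proj_act pk (act1 polX).
Qed.

(** The slices give local injectivity at the classes of [(1, q)]; the action
    of [E] carries it to every point. *)
Lemma coset_proj_locally_injective t :
  exists2 W, open_nbhs t W & {in W &, injective pr}.
Proof.
have [[e q] <-] := coset_surjective t.
have [W [oW W1 Wsat Winj]] := regular_slice polX secx E q regx.
have [cc _ cq] := kq.
have WE z : (kappa @` W) (kappa z) -> W z.
  by move=> [y Wy /keq yz]; exact: Wsat yz Wy.
exists (coset_act e @` (kappa @` W)).
  split.
    apply: (homeo_open (coset_act_homeo e)); apply: cq.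
    by rewrite (_ : _ @^-1` _ = W) // eqEsubset; split => [z /WE|z Wz] //; exists z.
  by exists (kappa (1%g, q)); [exists (1%g, q)|rewrite coset_actE /= mulg1].
move=> _ _ /set_mem[_ [y Wy <-] <-] /set_mem[_ [z Wz <-] <-].
rewrite !coset_proj_act => /(can_inj (actK polX (p e))); rewrite !prk => yz.
by congr coset_act; apply/keq; exact: Winj.
Qed.

Lemma coset_proj_surjective b : exists t, pr t = b.
Proof.
have [_ phiT _] := ext_phi_quotient; have : setT b by [].
by rewrite -phiT => -[z _ <-]; exists (kappa z); rewrite prk.
Qed.

Lemma coset_proj_covering : covering_map pr.
Proof.
apply: (covering_of_translations (D := [set coset_act k | k in p @^-1` [set 1%g]])).
- exact: coset_proj_continuous.
- exact: coset_proj_open.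
- exact: coset_proj_surjective.
- move=> _ [k /= pk <-]; split; first exact: homeo_open (coset_act_homeo k).
  by move=> t; rewrite coset_proj_act pk (act1 polX).
- by move=> t t' /coset_act_transitive[k pk kt]; exists (coset_act k) => //; exists k.
- move=> _ _ t [k /= pk <-] [k' /= pk' <-] kt.
  by rewrite (coset_act_free _ kt) // pk pk'.
- exact: coset_proj_locally_injective.
Qed.

End quotient.

Definition c_space : topologicalType := quot_space crel.
Definition c_pi : E * Q -> c_space := quot_pi crel.

Lemma c_pi_eq y z : c_pi y = c_pi z <-> crel y z.
Proof.
split => [/eqmodP/asboolP|yz]; last by apply/eqmodP/asboolP/rst_step.
elim => [{}y {}z //|{}y|{}y {}z _|{}y {}z w _ yz _ zw].
- exact: coset_rel_refl.
- exact: coset_rel_sym.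
- exact: coset_rel_trans yz zw.
Qed.

Lemma c_pi_surjective t : exists z, c_pi z = t.
Proof. by exists (repr t); exact: reprK. Qed.

Lemma c_pi_quotient : quotient_map c_pi.
Proof.
split => //; first exact: pi_continuous.
rewrite eqEsubset; split => // t _; have [z <-] := c_pi_surjective t.
by exists z.
Qed.

Lemma c_proj_ex : exists2 f : c_space -> X, continuous f &
  forall z, f (c_pi z) = ext_phi z.
Proof.
apply: (quotient_map_factor c_pi_quotient); first by case: ext_phi_quotient.
by move=> y z /c_pi_eq; exact: (ext_phi_coset polX).
Qed.

Definition c_proj : c_space -> X := projT1 (cid2 c_proj_ex).

Lemma c_projE z : c_proj (c_pi z) = ext_phi z.
Proof. by rewrite /c_proj; case: cid2. Qed.

Let c_mul : E -> c_space -> c_space := coset_act c_pi_quotient c_pi_eq.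

Lemma c_polar : polar_covering act c_proj.
Proof.
split.
- exact: (coset_proj_covering c_pi_quotient c_pi_eq c_projE).
- exact: ext_ubiquitous.
- move=> t t' /(coset_act_transitive c_pi_quotient c_pi_eq c_projE)[k pk kt].
  exists (c_mul k); split => // [|w]; first exact: coset_act_homeo.
  by rewrite (coset_proj_act _ _ c_projE) pk (act1 polX).
- move=> g; have [e <-] := ext_surjective (ext_discrete E) g.
  exists (c_mul e); split; first exact: coset_act_homeo.
  exact: (coset_proj_act _ _ c_projE).
Qed.

Definition c_lift (q : Q) : c_space := c_pi (1%g, q).

Lemma c_lift_continuous : continuous c_lift.
Proof.
move=> q; apply: (@continuous_at_comp _ _ _ q (fun q => (1%g : E, q)) c_pi).
  apply: continuous_at_pair; first exact: continuous_at_cst.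
  exact: continuous_at_id.
by case: c_pi_quotient => cc _ _; exact: cc.
Qed.

Lemma c_liftP q : c_proj (c_lift q) = x q.
Proof. by rewrite c_projE /ext_phi /phi /= p1 (act1 polX). Qed.

Definition c_polcov : polcov x := PolCov c_polar c_lift_continuous c_liftP.

End object.

Section morphism.
Variables (E1 E2 : ext x) (f : ext_hom E1 E2).

Lemma c_map_ex : exists2 g : c_polcov E1 -> c_polcov E2, continuous g &
  forall z, g (@c_pi E1 z) = @c_pi E2 (f z.1, z.2).
Proof.
have [fc fM] := eh_morphism f.
apply: (quotient_map_factor (c_pi_quotient E1)
  (f := fun z => @c_pi E2 (f z.1, z.2))).
  move=> z; apply: (@continuous_at_comp _ _ _ z (fun z => (f z.1, z.2)) (@c_pi E2)).
    apply: (@continuous_at_pair _ _ _ z (f \o fst) snd); last exact: cvg_snd.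
    by apply: (@continuous_at_comp _ _ _ z fst f); [exact: cvg_fst|exact: fc].
  by case: (c_pi_quotient E2) => cc _ _; exact: cc.
move=> y _ /c_pi_eq[h [hy ->]]; apply/c_pi_eq; exists h => /=.
by rewrite -(eh_u f) /= fM; split.
Qed.

Definition c_map : c_polcov E1 -> c_polcov E2 := projT1 (cid2 c_map_ex).

Lemma c_map_continuous : continuous c_map.
Proof. by rewrite /c_map; case: cid2. Qed.

Lemma c_mapE z : c_map (@c_pi E1 z) = @c_pi E2 (f z.1, z.2).
Proof. by rewrite /c_map; case: cid2. Qed.

Lemma c_map_proj t : pc_proj (c_map t) = pc_proj t.
Proof.
have [z <-] := c_pi_surjective t; rewrite c_mapE /= !c_projE /ext_phi /=.
by rewrite eh_proj.
Qed.

Lemma c_map_lift q : c_map (pc_lift (c_polcov E1) q) = pc_lift (c_polcov E2) q.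
Proof.
rewrite /= /c_lift c_mapE /=; congr (c_pi (_, _)).
have [_ fM] := eh_morphism f.
by apply: (mulgI (f 1%g)); rewrite -fM !mulg1.
Qed.

Definition c_hom : polcov_hom (c_polcov E1) (c_polcov E2) :=
  PolCovHom c_map_continuous c_map_proj c_map_lift.

End morphism.

Lemma c_hom1 (E : ext x) : c_hom (ext_id E) = polcov_id (c_polcov E).
Proof.
apply: polcov_hom_eq; apply: funext => t /=; have [z <-] := c_pi_surjective t.
by rewrite c_mapE /= -surjective_pairing.
Qed.

Lemma c_homM (E1 E2 E3 : ext x) (f : ext_hom E2 E3) (g : ext_hom E1 E2) :
  c_hom (ext_comp f g) = polcov_comp (c_hom f) (c_hom g).
Proof.
apply: polcov_hom_eq; apply: funext => t /=; have [z <-] := c_pi_surjective t.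
by rewrite !c_mapE.
Qed.

Definition c_functor : functor (E_cat x) (Pol_Cov x) :=
  @Functor (E_cat x) (Pol_Cov x) c_polcov c_hom c_hom1 c_homM.

Definition c_quot (E : ext x) : E * Q -> (c_functor E : polcov x) := @c_pi E.

Lemma c_functorP : C_functor c_quot.
Proof.
split => [E|E1 E2 f z]; last exact: c_mapE.
split.
- exact: c_pi_quotient.
- exact: c_pi_eq.
- exact: c_projE.
- by [].
Qed.

End c_space.

(** * The equivalence *)

Section equivalence.
Variables (R : realType) (G : lieGroupType R) (X : topologicalType).
Variables (act : G -> X -> X) (x : orbit_space act -> X).
Hypotheses (polX : polar_space act) (secx : polar_section x).
Local Notation Q := (orbit_space act).
Local Notation H := (isotropy x).

Lemma polcov_hom_factor (S : topologicalType) (P1 P2 : polcov x)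
    (q1 : S -> P1) (q2 : S -> P2) (l : Q -> S) :
  quotient_map q1 -> continuous q2 ->
  (forall z z', q1 z = q1 z' -> q2 z = q2 z') ->
  (forall z, pc_proj (q2 z) = pc_proj (q1 z)) ->
  (forall q, q1 (l q) = pc_lift P1 q) -> (forall q, q2 (l q) = pc_lift P2 q) ->
  exists f : polcov_hom P1 P2, forall z, f (q1 z) = q2 z.
Proof.
move=> q1q q2c q12 pq ql1 ql2; have [f fc fE] := quotient_map_factor q1q q2c q12.
have fp y : pc_proj (f y) = pc_proj y.
  have [_ q1T _] := q1q; have : setT y by [].
  by rewrite -q1T => -[z _ <-]; rewrite fE.
have fl q : f (pc_lift P1 q) = pc_lift P2 q by rewrite -ql1 fE.
by exists (PolCovHom fc fp fl).
Qed.

(** A group of lifts of [P] with a continuous action is unique as a topological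
    group: both groups are the set of all lifts, and [lift_group_continuous]
    applies to the identity of this set. *)
Lemma lift_group_hom (P : polcov x) (E1 E2 : ext x)
    (a1 : E1 -> P -> P) (a2 : E2 -> P -> P) :
  lift_group (@ext_proj _ _ _ _ _ E1) a1 -> lift_group (@ext_proj _ _ _ _ _ E2) a2 ->
  (forall g h y, a1 (g * h)%g y = a1 g (a1 h y)) ->
  (forall g h y, a2 (g * h)%g y = a2 g (a2 h y)) ->
  (forall h : H, cov_isotropy a1 (ext_u E1 h)) ->
  (forall h : H, cov_isotropy a2 (ext_u E2 h)) ->
  exists f : ext_hom E1 E2, forall g, a2 (f g) = a1 g.
Proof.
move=> L1 L2 aM1 aM2 u1 u2.
have [_ a1T _ _ a1c] := L1; have [a2I a2T _ _ _] := L2.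
have ex g : exists k, a2 k = a1 g.
  have : range a1 (a1 g) by exists g.
  by rewrite a1T -a2T => -[k _ <-]; exists k.
have [f fE] := choice ex.
have fp g : ext_proj (f g) = ext_proj g.
  apply: (lifts_action_unique polX (lift_groupP L2 _)).
  by rewrite fE; exact: lift_groupP.
have [q0 _] := orbit_inhabited polX.
have fc : continuous f.
  move=> g; apply: (lift_group_continuous L2 (f := f) (y := fun=> pc_lift P q0)).
  - rewrite (_ : _ \o _ = @ext_proj _ _ _ _ _ E1); last exact: funext.
    by apply: (covering_continuous (discrete_extension_covering (ext_discrete E1))).
  - exact: continuous_at_cst.
  - rewrite (_ : (fun b => _) = fun g => a1 g (pc_lift P q0)).
      apply: (@continuous_at_comp _ _ _ g (fun g => (g, pc_lift P q0))
        (fun z : E1 * P => a1 z.1 z.2)); last exact: a1c.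
      apply: continuous_at_pair; first exact: continuous_at_id.
      exact: continuous_at_cst.
    by apply: funext => h; rewrite fE.
have fM : {morph f : g h / (g * h)%g}.
  by move=> g h; apply: a2I; apply: funext => y; rewrite aM2 !fE aM1.
have fu (h : H) : (f (ext_u E1 h).1, (ext_u E1 h).2) = ext_u E2 h.
  rewrite [RHS]surjective_pairing !ext_u2; congr pair.
  have := u1 h; have := u2 h; rewrite /cov_isotropy /= !ext_u2 => u2h u1h.
  apply: (lift_group_eq L2 (y := pc_lift P (set_val h).2)); last by rewrite fE u1h.
  by rewrite fp; have := ext_lift E1 h; rewrite -(ext_lift E2 h) => -[].
by exists (ExtHom (conj fc fM) fp fu).
Qed.

Section coset_lift_group.
Variables (E : ext x) (P : polcov x) (k : E * Q -> P).
Hypotheses (kq : quotient_map k)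
  (keq : forall y z, k y = k z <-> coset_rel (ext_u E) y z).
Hypothesis kproj : forall z, pc_proj (k z) = ext_phi z.
Let covp := discrete_extension_covering (ext_discrete E).

Lemma coset_act_lifts e :
  lifts_action act (@pc_proj _ _ _ _ _ P) (ext_proj e) (coset_act kq keq e).
Proof.
split; first exact: coset_act_homeo.
by move=> y; rewrite (coset_proj_act polX kq keq kproj).
Qed.

(** A lift of [ext_proj e] differs from [coset_act e] by a deck transformation,
    which is the action of a kernel element. The action is continuous because at
    the class of [(1, q0)] it is [fun e => k (e, q0)]. *)
Lemma coset_lift_group : lift_group (@ext_proj _ _ _ _ _ E) (coset_act kq keq).
Proof.
have [q0 _] := orbit_inhabited polX.
split.
- move=> e e' ee'; apply: (coset_act_free polX (kq := kq) (keq := keq)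
    (t := k (1%g, q0))); last by rewrite ee'.
  apply: (lifts_action_unique polX (coset_act_lifts e)).
  by rewrite ee'; exact: coset_act_lifts.
- rewrite eqEsubset; split => [_ [e _ <-]|f [g fg]].
    by exists (ext_proj e); exact: coset_act_lifts.
  have [e eg] := ext_surjective (ext_discrete E) g.
  pose y := pc_lift P q0.
  have : pc_proj (coset_act kq keq e y) = pc_proj (f y).
    by case: fg => _ ->; case: (coset_act_lifts e) => _ ->; rewrite eg.
  move=> /(coset_act_transitive polX secx kq keq kproj)[c pc ce].
  exists (c * e)%g => //; apply: (lifts_action_eq (coset_act_lifts _) _ (y := y)).
    by rewrite (extM (ext_discrete E)) pc mul1g eg.
  by rewrite coset_actM.
- by move=> e y; case: (coset_act_lifts e).
- exact: covp.
move=> [e y].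
apply: (covering_lift_continuous (pc_covering P) (F := coset_act kq keq)
  (f := fun z : E * P => act (ext_proj z.1) (pc_proj z.2)) (y0 := k (1%g, q0))).
- exact: pc_connected.
- apply: (covering_locally_connected (pc_covering P)).
  apply: (@locally_path_connected_locally_connected R).
  by case: polX => _ [].
- move=> z; apply: (@continuous_at_comp _ _ _ (e, z)
    (fun z : E * P => (ext_proj z.1, pc_proj z.2)) (fun z : G * X => act z.1 z.2)).
    apply: continuous_at_pair.
      by apply: continuous_at_comp; [exact: cvg_fst|exact: (covering_continuous covp)].
    apply: continuous_at_comp; first exact: cvg_snd.
    exact: (covering_continuous (pc_covering P)).
  exact: (act_continuous polX).
- apply: near_all => f; split; first exact: coset_act_continuous.
  by move=> z; case: (coset_act_lifts f).
- rewrite (_ : (fun f => _) = fun f => k (f, q0)).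
    apply: (@continuous_at_comp _ _ _ e (fun e => (e, q0)) k).
      apply: continuous_at_pair; first exact: continuous_at_id.
      exact: continuous_at_cst.
    by case: kq => kc _ _; exact: kc.
  by apply: funext => f; rewrite coset_actE /= mulg1.
Qed.

Lemma coset_act_isotropy (h : H) : (forall q, pc_lift P q = k (1%g, q)) ->
  cov_isotropy (coset_act kq keq) (ext_u E h).
Proof.
move=> kl.
rewrite /cov_isotropy /= kl coset_actE /= mulg1; apply/keq/(coset_rel_sym polX).
by exists h; rewrite /= mul1g.
Qed.

End coset_lift_group.

Section functors.
Variables (Br : functor (Pol_Cov x) (E_cat x))
  (a : forall P : polcov x, (Br P : ext x) -> P -> P).
Variables (C : functor (E_cat x) (Pol_Cov x))
  (k : forall E : ext x, E * Q -> (C E : polcov x)).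
Hypotheses (BrP : Br_functor a) (CP : C_functor k).

Let kq E : quotient_map (@k E). Proof. by case: CP => /(_ E)[]. Qed.
Let keq E : forall y z, k y = k z <-> coset_rel (ext_u E) y z.
Proof. by case: CP => /(_ E)[]. Qed.
Let kl E : forall q, pc_lift (C E : polcov x) q = @k E (1%g, q).
Proof. by case: CP => /(_ E)[]. Qed.
Let aM P : forall (g h : (Br P : ext x)) y, @a P (g * h)%g y = @a P g (@a P h y).
Proof. by case: BrP => /(_ P)[[[]]]. Qed.

Let a_lift_group P : lift_group (@ext_proj _ _ _ _ _ (Br P : ext x)) (@a P).
Proof. by case: BrP => /(_ P)[[[aI aT _ pa] [ac acont]] _] _; split. Qed.

Let a_isotropy P h : cov_isotropy (@a P) (ext_u (Br P : ext x) h).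
Proof. by case: BrP => /(_ P)[_ []]. Qed.

(** The orbit map of the lifted section: with [k], it presents [P] and [C (Br P)]
    as quotients of one space by one relation. *)
Let theta (P : polcov x) (z : (Br P : ext x) * Q) : P := @a P z.1 (pc_lift P z.2).

Let theta_quotient P : quotient_map (@theta P).
Proof. exact: (lift_group_quotient polX secx (a_lift_group P)). Qed.

Let theta_eq P y z : @theta P y = theta z <-> k y = k z.
Proof.
have prM := extM (ext_discrete (Br P : ext x)).
have [_ u_uniq] : br_u_spec (@a P) by case: BrP => /(_ P)[].
have := coset_relP polX secx (a_lift_group P) prM (@aM P) (@a_isotropy P) u_uniq y z.
by move=> [cy cz]; split => [/cy/keq|/keq/cz].
Qed.

Let theta_proj P z : pc_proj (@theta P z) = pc_proj (k z).
Proof.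
have [_ _ pa _ _] := a_lift_group P.
have [_ _ -> _] := CP.1 (Br P : ext x).
by rewrite /theta pa pc_liftP.
Qed.

Let theta_lift P q : @theta P (1%g, q) = pc_lift P q.
Proof. by rewrite /theta /= (lift_group_a1 (a_lift_group P) (@aM P)). Qed.

Lemma C_Br_isomorphic :
  naturally_isomorphic (functor_comp C Br) (functor_id (Pol_Cov x)).
Proof.
have s_ex (P : polcov x) : exists f : polcov_hom (C (Br P)) P,
    forall z, f (k z) = theta z.
  apply: (polcov_hom_factor (l := fun q => (1%g, q)) (kq _)).
  - by case: (theta_quotient P).
  - by move=> y z /theta_eq.
  - by move=> z; rewrite theta_proj.
  - by move=> q; rewrite kl.
  - exact: theta_lift.
have t_ex (P : polcov x) : exists f : polcov_hom P (C (Br P)),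
    forall z, f (theta z) = k z.
  apply: (polcov_hom_factor (l := fun q => (1%g, q)) (theta_quotient P)).
  - by case: (kq (Br P)).
  - by move=> y z /theta_eq.
  - by move=> z; rewrite theta_proj.
  - exact: theta_lift.
  - by move=> q; rewrite kl.
pose s P := projT1 (cid (s_ex P)); pose t P := projT1 (cid (t_ex P)).
have sE P z : s P (k z) = theta z by exact: (projT2 (cid (s_ex P))).
have tE P z : t P (theta z) = k z by exact: (projT2 (cid (t_ex P))).
exists s, t; split => [P|P|P1 P2 f]; apply: polcov_hom_eq; apply: funext => y /=.
- by have [z <-] := coset_surjective (kq _) y; rewrite sE tE.
- by have [z <-] := coset_surjective (theta_quotient P) y; rewrite tE sE.
have [z <-] := coset_surjective (kq _) y.
by rewrite (CP.2 _ _ (Defs.fmap Br f)) !sE /theta (BrP.2 _ _ f) pch_lift.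
Qed.

(** Both [Br (C E)] and [E] are the group of lifts of [C E], with continuous
    actions. *)
Lemma Br_C_isomorphic :
  naturally_isomorphic (functor_comp Br C) (functor_id (E_cat x)).
Proof.
have kproj E z : pc_proj (@k E z) = ext_phi z by have [_ _ kp _] := CP.1 E; exact: kp.
pose b (E : ext x) := coset_act (kq E) (@keq E).
have bL E := coset_lift_group (kq E) (@keq E) (kproj E).
have bM E g h y : b E (g * h)%g y = b E g (b E h y) by exact: coset_actM.
have bu E h := coset_act_isotropy (kq E) (@keq E) h (@kl E).
have s_ex (E : ext x) : exists f : ext_hom (Br (C E)) E,
    forall g, b E (f g) = @a (C E) g.
  exact: (lift_group_hom (a_lift_group (C E)) (bL E) (@aM _)
    (bM E) (@a_isotropy _) (bu E)).
have t_ex (E : ext x) : exists f : ext_hom E (Br (C E)),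
    forall g, @a (C E) (f g) = b E g.
  exact: (lift_group_hom (bL E) (a_lift_group (C E)) (bM E)
    (@aM _) (bu E) (@a_isotropy _)).
pose s E := projT1 (cid (s_ex E)); pose t E := projT1 (cid (t_ex E)).
have sE E g : b E (s E g) = @a (C E) g by exact: (projT2 (cid (s_ex E))).
have tE E g : @a (C E) (t E g) = b E g by exact: (projT2 (cid (t_ex E))).
exists s, t; split => [E|E|E1 E2 f]; apply: ext_hom_eq; apply: funext => g /=.
- by have [aI _ _ _ _] := a_lift_group (C E); apply: aI; rewrite tE sE.
- by have [bI _ _ _ _] := bL E; apply: bI; exact: etrans (sE _ _) (tE _ _).
have [q0 _] := orbit_inhabited polX.
pose y := @k E1 (1%g, q0).
apply: (lift_group_eq (bL E2) (y := (Defs.fmap C f : polcov_hom (C E1) (C E2)) y)).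
  by rewrite !eh_proj.
rewrite -/(b E2) sE -(BrP.2 _ _ (Defs.fmap C f)) -sE /b /y (CP.2 _ _ f) !coset_actE /=.
by rewrite (CP.2 _ _ f) /=; have [_ ->] := eh_morphism f.
Qed.

End functors.

End equivalence.

Theorem theorem2p19 (R : realType) (G : lieGroupType R) (X : topologicalType)
    (act : G -> X -> X) (x : orbit_space act -> X)
    (regX : regular_polar_space act)
    (secx : polar_section x) (regx : regular_section x) :
  [/\ exists (Br : functor (Pol_Cov x) (E_cat x))
             (a : forall P : polcov x, (Br P : ext x) -> P -> P),
        Br_functor a,
      exists (C : functor (E_cat x) (Pol_Cov x))
             (k : forall E : ext x, E * orbit_space act -> (C E : polcov x)),
        C_functor k &
      forall (Br : functor (Pol_Cov x) (E_cat x))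
             (a : forall P : polcov x, (Br P : ext x) -> P -> P)
             (C : functor (E_cat x) (Pol_Cov x))
             (k : forall E : ext x, E * orbit_space act -> (C E : polcov x)),
        Br_functor a -> C_functor k -> equivalence_of_categories Br C].
Proof.
have [polX _] := regX; split.
- by exists (br_functor polX secx), (@br_act _ _ _ _ _ polX secx); exact: br_functorP.
- by exists (c_functor polX secx regx), (@c_quot _ _ _ _ _ polX secx regx);
    exact: c_functorP.
- move=> Br a C k BrP CP; split.
    exact: (C_Br_isomorphic polX secx BrP CP).
  exact: (Br_C_isomorphic polX secx BrP CP).
Qed.
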